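(* Let $\overline{M}$ be a smooth manifold of dimension $n+1$ with boundary $\partial M$ and interior $M$. Suppose that $g$ is a projectively compact pseudo-Riemannian Einstein metric on $M$ with non-zero scalar curvature $R$. Then for any local defining function $\rho$ for $\partial M$, the symmetric $\binom{0}{2}$-tensor field $$\rho g+\frac{n(n+1)}{4R}\frac{d\rho^2}{\rho}$$ on $M$ (on the domain of $\rho$) extends smoothly to the boundary and its boundary value restricts to a non-degenerate symmetric bilinear form on $T\partial M$. Thus $g$ has an asymptotic form $$g=\frac{h}{\rho}+C\frac{d\rho\odot d\rho}{\rho^{2}}$$ with $C=\frac{-n(n+1)}{4R}$ and with $h$ smooth up to the boundary and non-degenerate on $T\partial M$.
   Context: All affine connections are torsion free; smooth means $C^\infty$. For a one-form $\Upsilon$, $\nabla+\Upsilon$ denotes the connection $(\xi,\eta)\mapsto\nabla_\xi\eta+\Upsilon(\xi)\eta+\Upsilon(\eta)\xi$. A local defining function for $\partial M$ is a smooth $\rho:U\to\mathbb{R}_{\ge0}$, $U\subset\overline{M}$ open, with $\rho^{-1}(\{0\})=U\cap\partial M$ and $d\rho\neq0$ along $U\cap\partial M$. A pseudo-Riemannian metric $g$ on $M$ with Levi-Civita connection $\nabla$ is projectively compact of order $\alpha>0$ if near each boundary point there is a defining function $\rho$ such that $\nabla+\frac{d\rho}{\alpha\rho}$ extends smoothly to the boundary; it is projectively compact if this holds for some order $\alpha>0$. Einstein means $\mathrm{Ric}=\frac{R}{n+1}g$ with $R$ constant. $d\rho^2=d\rho\odot d\rho$ is the tensor $(\xi,\eta)\mapsto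 d\rho(\xi)d\rho(\eta)$. *)

(* Defs.v *)
From HB Require Import structures.
From mathcomp Require Import all_boot all_order all_algebra.
From mathcomp Require Import boolp classical_sets functions cardinality reals.
From mathcomp Require Import topology normedtype.

Set Implicit Arguments.
Unset Strict Implicit.
Unset Printing Implicit Defensive.

Import Order.TTheory GRing.Theory Num.Theory.
Import numFieldNormedType.Exports.

Local Open Scope classical_set_scope.
Local Open Scope ring_scope.

Section HalfSpaceCalculus.
Variables (R : realType) (n : nat).
Implicit Types (x : 'rV[R]_n.+1) (a : 'I_n.+1) (f : 'rV[R]_n.+1 -> R).

Definition half_space : set 'rV[R]_n.+1 := [set x | 0 <= x 0 ord0].

(* Increments that leave the half-space are not used: the partial derivative  *)
(* is the usual two-sided one, except for the one normal to the hyperplane at *)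
(* points of the hyperplane, which is one-sided.                              *)
Definition pd_filter a x : set_system R :=
  within [set t : R | half_space (x + t *: delta_mx 0 a)] 0^'.

Definition pd_quotient a f x (t : R) : R :=
  t^-1 * (f (x + t *: delta_mx 0 a) - f x).

Definition has_pd a f x : Prop := cvg (pd_quotient a f x @ pd_filter a x).

Definition pd a f x : R := lim (pd_quotient a f x @ pd_filter a x).

(* C^k up to the boundary, for U relatively open in the half-space: all       *)
(* partial derivatives of order <= k exist and are continuous on U, boundary  *)
(* points included.                                                           *)
Fixpoint Ck_on (k : nat) (U : set 'rV[R]_n.+1) f : Prop :=
  {within U, continuous f} /\
  if k is k'.+1 then
    forall a, (forall x, U x -> has_pd a f x) /\ Ck_on k' U (pd a f)
  else True.

Definition Cinfty_on U f : Prop := forall k, Ck_on k U f.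

End HalfSpaceCalculus.

Record chart (R : realType) (n : nat) (X : topologicalType) := Chart {
  chart_dom : set X;
  chart_map : X -> 'rV[R]_n.+1;
  chart_inv : 'rV[R]_n.+1 -> X;
  chart_dom_open : open chart_dom;
  chart_img_open : exists2 V : set 'rV[R]_n.+1,
    open V & chart_map @` chart_dom = V `&` @half_space R n;
  chart_mapK : forall p, chart_dom p -> chart_inv (chart_map p) = p;
  chart_map_continuous : {within chart_dom, continuous chart_map};
  chart_inv_continuous :
    {within chart_map @` chart_dom, continuous chart_inv}
}.

(* Smooth (n+1)-manifolds with (possibly empty) boundary; the atlas need not  *)
(* be maximal.                                                                *)
Record bd_manifold (R : realType) (n : nat) := BdManifold {
  carrier :> topologicalType;
  index : Type;
  atlas : index -> chart R n carrier;
  manifold_hausdorff : hausdorff_space carrier;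
  manifold_second_countable : @second_countable carrier;
  atlas_cover : forall p : carrier, exists i, chart_dom (atlas i) p;
  atlas_compatible : forall i j (c : 'I_n.+1),
    Cinfty_on
      (chart_map (atlas i) @` (chart_dom (atlas i) `&` chart_dom (atlas j)))
      (fun x => chart_map (atlas j) (chart_inv (atlas i) x) 0 c)
}.

Section ManifoldWithBoundary.
Variables (R : realType) (n : nat) (M : bd_manifold R n).
Implicit Types (W : set M) (i j : index M) (p : M) (f : M -> R).
Implicit Types (a b c d k l : 'I_n.+1).

Definition dom i : set M := chart_dom (atlas i).

Definition coord i p : 'rV[R]_n.+1 := chart_map (atlas i) p.

Definition manifold_boundary : set M :=
  [set p | exists i, dom i p /\ coord i p 0 ord0 = 0].

Definition manifold_interior : set M := ~` manifold_boundary.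

(* \partial f / \partial x_i^a at p, where x_i are the coordinates of chart i *)
Definition partial i a f p : R := pd a (f \o chart_inv (atlas i)) (coord i p).

Definition smooth_on W f : Prop :=
  forall i, Cinfty_on (coord i @` (W `&` dom i)) (f \o chart_inv (atlas i)).

Definition differential f i p : 'rV[R]_n.+1 := \row_a partial i a f p.

(* (jacobian i j p) a c = \partial x_j^c / \partial x_i^a                     *)
Definition jacobian i j p : 'M[R]_n.+1 :=
  \matrix_(a, c) partial i a (fun q => coord j q 0 c) p.

(* A (0,2)-tensor field is given by its components: t i p a b is              *)
(* t(d/dx_i^a, d/dx_i^b) at p.  Values at p outside dom i, or outside the set *)
(* where the field is considered, are irrelevant.                             *)
Definition tensor02 := index M -> M -> 'M[R]_n.+1.

Definition smooth_sym_tensor_on W (t : tensor02) : Prop :=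
  [/\ forall i p, W p -> dom i p -> (t i p)^T = t i p,
      forall i j p, W p -> dom i p -> dom j p ->
        t i p = jacobian i j p *m t j p *m (jacobian i j p)^T &
      forall i a b, smooth_on (W `&` dom i) (fun p => t i p a b)].

Definition nondegenerate_on (S : set 'rV[R]_n.+1) (t : 'M[R]_n.+1) : Prop :=
  forall v, S v -> (forall w, S w -> (v *m t *m w^T) 0 0 = 0) -> v = 0.

(* At a boundary point, a vector with components v in any chart is tangent to *)
(* the boundary iff v_0 = 0.                                                  *)
Definition boundary_vectors : set 'rV[R]_n.+1 := [set v | v 0 ord0 = 0].

(* An affine connection is given by its coefficients:                         *)
(* \nabla_(d/dx_i^a) (d/dx_i^b) = \sum_k G i p k a b d/dx_i^k.                *)
Definition connection := index M -> M -> 'I_n.+1 -> 'I_n.+1 -> 'I_n.+1 -> R.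

Definition smooth_torsion_free_connection_on W (G : connection) : Prop :=
  [/\ forall i p k a b, W p -> dom i p -> G i p k a b = G i p k b a,
      forall i j p a b c, W p -> dom i p -> dom j p ->
        \sum_k G i p k a b * jacobian i j p k c =
        partial i a (partial i b (fun q => coord j q 0 c)) p +
        \sum_d \sum_l G j p c d l * jacobian i j p a d * jacobian i j p b l &
      forall i k a b, smooth_on (W `&` dom i) (fun p => G i p k a b)].

Definition pseudo_riemannian (g : tensor02) : Prop :=
  smooth_sym_tensor_on manifold_interior g /\
  forall i p, manifold_interior p -> dom i p -> nondegenerate_on setT (g i p).

Definition levi_civita (g : tensor02) (G : connection) : Prop :=
  smooth_torsion_free_connection_on manifold_interior G /\
  forall i p a b c, manifold_interior p -> dom i p ->
    partial i c (fun q => g i q a b) p =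
    \sum_k (G i p k c a * g i p k b + G i p k c b * g i p a k).

(* R(d_a, d_b) d_c = \sum_k (riemann G i p k c a b) d_k                       *)
Definition riemann (G : connection) i p k c a b : R :=
  partial i a (fun q => G i q k b c) p - partial i b (fun q => G i q k a c) p
  + \sum_l (G i p k a l * G i p l b c - G i p k b l * G i p l a c).

(* Ric(xi, eta) is the trace of zeta |-> R(zeta, xi) eta.                     *)
Definition ricci (G : connection) i p : 'M[R]_n.+1 :=
  \matrix_(b, c) \sum_k riemann G i p k c k b.

Definition scalar_curvature (g : tensor02) (G : connection) i p : R :=
  \tr (invmx (g i p) *m ricci G i p).

(* G is meant to be the Levi-Civita connection of g.                          *)
Definition einstein_with_scalar_curvature
    (g : tensor02) (G : connection) (S : R) : Prop :=
  forall i p, manifold_interior p -> dom i p ->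
    scalar_curvature g G i p = S /\
    ricci G i p = (S / n.+1%:R) *: g i p.

Definition local_defining_function W (rho : M -> R) : Prop :=
  [/\ open W,
      smooth_on W rho,
      forall p, W p -> 0 <= rho p,
      forall p, W p -> (rho p = 0 <-> manifold_boundary p) &
      forall i p, W p -> manifold_boundary p -> dom i p ->
        differential rho i p != 0].

Definition projective_change (G : connection)
    (U : index M -> M -> 'rV[R]_n.+1) : connection :=
  fun i p k a b =>
    G i p k a b + U i p 0 a * (k == b)%:R + U i p 0 b * (k == a)%:R.

Definition projectively_compact_of_order (G : connection) (alpha : R) : Prop :=
  forall p, manifold_boundary p ->
    exists W (rho : M -> R) (Gbar : connection),
      [/\ local_defining_function W rho, W p,
          smooth_torsion_free_connection_on W Gbar &
          forall i q k a b, W q -> manifold_interior q -> dom i q ->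
            Gbar i q k a b =
            projective_change G
              (fun j r => (alpha * rho r)^-1 *: differential rho j r)
              i q k a b].

Definition projectively_compact (G : connection) : Prop :=
  exists2 alpha : R, 0 < alpha & projectively_compact_of_order G alpha.

Definition differential_sq (rho : M -> R) : tensor02 :=
  fun i p => (differential rho i p)^T *m differential rho i p.

End ManifoldWithBoundary.

(* Main.v *)
(* Fix a chart around a boundary point, let [nabla + U] with [U = d rho_0 /   *)
(* (alpha rho_0)] extend smoothly to the boundary, and put [lam = S / (n (n + *)
(* 1))] and [tau = rho_0 ^ (2 / alpha)].  On the interior the Einstein        *)
(* equation makes [tau], [omega = d tau / 2] and [kappa = tau (lam g + U U)]  *)
(* a solution of a closed linear first-order system whose coefficients (the   *)
(* connection [nabla + U] and its projective Schouten tensor) are smooth up   *)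
(* to the boundary: the entries of a parallel tractor metric [H].  By         *)
(* Gronwall, [H] is bounded, hence Lipschitz, hence extends continuously, and *)
(* then smoothly since the system expresses its derivatives through itself.   *)
(* The same applies to [H^-1], so [H] is non-degenerate on the boundary.      *)
(* There [tau = 0], so [omega <> 0] and [kappa] is non-degenerate on [ker     *)
(* omega]; in other words [tau] is a defining function, and [g = kappa / (lam *)
(* tau) - d tau ^ 2 / (4 lam tau ^ 2)] is the asymptotic form for [tau].  Any *)
(* other defining function is [rho = v tau] with [v] smooth and non-vanishing *)
(* by Hadamard's lemma, and substituting [tau = rho / v] gives the asymptotic *)
(* form for [rho].                                                            *)
Require Import Defs.
From mathcomp Require Import all_boot all_order all_algebra.
From mathcomp Require Import boolp classical_sets functions cardinality reals.
From mathcomp Require Import topology normedtype sequences derive exp.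
From mathcomp Require Import ring lra zify.

Set Implicit Arguments.
Unset Strict Implicit.
Unset Printing Implicit Defensive.

Import Order.TTheory GRing.Theory Num.Theory.
Import numFieldNormedType.Exports.
Local Open Scope classical_set_scope.
Local Open Scope ring_scope.

(** * Increments along coordinate paths *)

(** Write [P] for the projective Schouten tensor of the extended connection [nabla + U]; it is
    smooth up to the boundary. The projective change of the Ricci tensor
    ([ricci_expr_projective_change]) and the Einstein equation give [nabla U = lam g + U U - P]
    ([Upsilon_covariant_derivative]). Since [d tau = 2 tau U], multiplication by [tau] closes this
    into a linear system without singular coefficients: the differential of [tau] is [2 omega], the
    [nabla + U]-derivative of [omega] is [kappa - tau P], and that of [kappa] is bilinear in [P] and
    [omega]. In matrix form, [dH = D H + H D^T] for the block matrix [H] of [kappa], [omega], [tau]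
    ([metric_derive]).

    Inside, [H] is congruent to the block sum of [tau lam g] and [tau], hence invertible
    ([metric_unit]), and [L = H^-1] solves the same kind of system with [- D^T]
    ([inverse_metric_derive]). [system_extension] applies to both, and [H L = 1] persists on the
    boundary by density. Non-degeneracy is thus obtained without estimating a determinant. On the
    boundary the last row of the extended [H] is [(omega, 0)] with [omega] conormal; this yields
    [d tau <> 0] and the non-degeneracy of [kappa] on tangent vectors ([chart_asymptotics]).

    The analysis rests on one principle. A function that is continuous up to the boundary, and whose
    interior partial derivatives extend continuously, has these extensions as its partial
    derivatives on the boundary ([C1_pd]). Iterated, an algebra of continuous functions closed under
    interior differentiation consists of smooth functions ([alg_Cinfty]). Algebraic operations,
    composites, solutions of the linear system and the quotients in Hadamard's lemma are all treated
    in this way.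

    On the manifold, [extended_form] takes limits along the normal coordinate direction at boundary
    points; [local_extension] shows that these limits are the values of the smooth chart extension.
    Symmetry and the transformation law pass from the interior to the boundary by continuity. *)

Section Boxes.
Context {R : realType} {n : nat}.
Implicit Types (x y z w : 'rV[R]_n.+1) (a b : 'I_n.+1) (e eps : R).

Lemma row_norm_ltP x e : 0 < e -> (`|x| < e) <-> (forall a, `|x 0 a| < e).
Proof.
move=> e0; rewrite [`|x|]/Num.Def.normr /= mx_normrE; split.
  by move=> /bigmax_ltP[_ h] a; apply: (h (0, a)).
by move=> h; apply/bigmax_ltP; split=> // -[i a] _ /=; rewrite ord1.
Qed.

Lemma coord_le_norm x a : `|x 0 a| <= `|x|.
Proof.
rewrite [X in _ <= X]/Num.Def.normr /= mx_normrE.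
exact: (le_bigmax _ (fun i : 'I_1 * 'I_n.+1 => `|x i.1 i.2|) (0, a)).
Qed.

Definition evec a : 'rV[R]_n.+1 := delta_mx 0 a.

Lemma shift_coord x t a b : (x + t *: evec a) 0 b = x 0 b + t *+ (b == a).
Proof. by rewrite !mxE eqxx /= mulr_natr. Qed.

Lemma sub_coord y x b : (y - x) 0 b = y 0 b - x 0 b.
Proof. by rewrite !mxE. Qed.

Lemma norm_scale_evec t a : `|t *: evec a| <= `|t|.
Proof.
rewrite [X in X <= _]/Num.Def.normr /= mx_normrE; apply/bigmax_leP; split=> //.
move=> [i b] _ /=; rewrite !mxE ord1 eqxx /=.
by case: (b == a); rewrite ?mulr1 ?mulr0 ?normr0.
Qed.

Definition open_box x (e : R) : set 'rV[R]_n.+1 :=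
  [set y | `|y - x| < e /\ 0 < y 0 ord0].

Definition half_box x (e : R) : set 'rV[R]_n.+1 :=
  [set y | `|y - x| < e /\ half_space y].

Lemma open_half_box x e : open_box x e `<=` half_box x e.
Proof. by move=> y [ye y0]; split=> //; apply: ltW. Qed.

Lemma is_derive_slice (f : 'rV[R]_n.+1 -> R) w v t d :
  is_derive (w + t *: v) v f d -> is_derive t 1 (fun s : R => f (w + s *: v)) d.
Proof.
have E : (fun h : R => h^-1 *: (((fun s : R => f (w + s *: v)) \o shift t) (h *: 1)
             - f (w + t *: v))) =
         (fun h : R => h^-1 *: ((f \o shift (w + t *: v)) (h *: v)
             - f (w + t *: v))).
  apply/funext => h /=; congr (_ *: (f _ - _)).
  by rewrite [h *: 1]mulr1 scalerDl addrCA.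
by case=> h1 h2; split; [rewrite /derivable E | rewrite /derive E].
Qed.

Lemma box_between x e w a s t :
  0 <= t <= s -> open_box x e w -> open_box x e (w + s *: evec a) ->
  open_box x e (w + t *: evec a).
Proof.
move=> /andP[t0 ts] [h1 h2] [h3 h4].
have e0 : 0 < e by apply: le_lt_trans h1.
split; last first.
  by rewrite !shift_coord in h4 *; case: (_ == _) h4; rewrite ?mulr1n ?mulr0n; lra.
apply/row_norm_ltP => // b.
move/(row_norm_ltP _ e0)/(_ b): h1; move/(row_norm_ltP _ e0)/(_ b): h3.
rewrite !sub_coord !shift_coord !ltr_norml => /andP[u1 u2] /andP[u3 u4].
apply/andP; case: (b == a) in u1 u2 *; rewrite ?mulr1n ?mulr0n in u1 u2 *; split; lra.
Qed.

Lemma increment_step_ge0 x e (f f' : 'rV[R]_n.+1 -> R) a (c eps : R) w (s : R) :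
  (forall y, open_box x e y -> is_derive y (evec a) f (f' y)) ->
  (forall y, open_box x e y -> `|f' y - c| <= eps) ->
  0 <= s -> open_box x e w -> open_box x e (w + s *: evec a) ->
  `|f (w + s *: evec a) - f w - c * s| <= eps * s.
Proof.
move=> hd hb s0 hw hs.
have inb t : t \in `[0, s] -> open_box x e (w + t *: evec a).
  by rewrite in_itv /= => ts; apply: box_between ts hw hs.
have [||t /inb tb] := @MVT_segment R (fun t => f (w + t *: evec a))
  (fun t => f' (w + t *: evec a)) 0 s s0.
- move=> t ts; apply: is_derive_slice; apply: hd; apply: inb.
  by apply: subset_itv_oo_cc.
- apply: derivable_within_continuous => t ts.
  by have [] := is_derive_slice (hd _ (inb _ ts)).
- rewrite scale0r addr0 subr0 => ->.
  by rewrite -mulrBl normrM (ger0_norm s0) ler_wpM2r // hb.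
Qed.

Lemma increment_step x e (f f' : 'rV[R]_n.+1 -> R) a (c eps : R) w (s : R) :
  (forall y, open_box x e y -> is_derive y (evec a) f (f' y)) ->
  (forall y, open_box x e y -> `|f' y - c| <= eps) ->
  open_box x e w -> open_box x e (w + s *: evec a) ->
  `|f (w + s *: evec a) - f w - c * s| <= eps * `|s|.
Proof.
move=> hd hb hw hs; have [s0|s0] := leP 0 s.
  by rewrite (ger0_norm s0); apply: (@increment_step_ge0 x e f f').
have E : w + s *: evec a + - s *: evec a = w by rewrite scaleNr addrK.
have := @increment_step_ge0 x e f f' a c eps (w + s *: evec a) (- s) hd hb.
rewrite E (ltr0_norm s0) => H.
have -> : f (w + s *: evec a) - f w - c * s =
  - (f w - f (w + s *: evec a) - c * - s) by lra.
by rewrite normrN; apply: H => //; lra.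
Qed.

Definition coord_path y z (k : nat) : 'rV[R]_n.+1 :=
  \row_b (if (b < k)%N then z 0 b else y 0 b).

Lemma coord_path0 y z : coord_path y z 0 = y.
Proof. by apply/rowP => b; rewrite mxE. Qed.

Lemma coord_path_full y z : coord_path y z n.+1 = z.
Proof. by apply/rowP => b; rewrite mxE ltn_ord. Qed.

Lemma coord_pathS y z a :
  coord_path y z a.+1 = coord_path y z a + (z 0 a - y 0 a) *: evec a.
Proof.
apply/rowP => b; rewrite shift_coord !mxE ltnS leq_eqVlt.
case: (eqVneq b a) => [->|ba]; first by rewrite eqxx ltnn /= mulr1n addrC subrK.
by rewrite (_ : (_ == _ :> nat) = false) ?mulr0n ?addr0 //; apply/eqP/eqP.
Qed.

Lemma coord_path_box x e y z k :
  open_box x e y -> open_box x e z -> open_box x e (coord_path y z k).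
Proof.
move=> [y1 y2] [z1 z2]; have e0 : 0 < e by apply: le_lt_trans y1.
split; last by rewrite mxE; case: ifP.
apply/row_norm_ltP => // b.
move/(row_norm_ltP _ e0)/(_ b): y1; move/(row_norm_ltP _ e0)/(_ b): z1.
by rewrite !mxE; case: ifP.
Qed.

(** The increment is telescoped along a path changing one coordinate at a time, which stays in the
    box; the one-variable mean value theorem handles each leg. Only directional derivatives enter,
    no total differentiability. *)
Lemma increment_open x e (f : 'rV[R]_n.+1 -> R)
    (f' : 'I_n.+1 -> 'rV[R]_n.+1 -> R) (c : 'I_n.+1 -> R) (eps : R) y z :
  (forall a w, open_box x e w -> is_derive w (evec a) f (f' a w)) ->
  (forall a w, open_box x e w -> `|f' a w - c a| <= eps) ->
  open_box x e y -> open_box x e z ->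
  `|f z - f y - \sum_a c a * (z 0 a - y 0 a)| <= eps * \sum_a `|z 0 a - y 0 a|.
Proof.
move=> hd hb hy hz.
have -> : f z - f y = \sum_(a < n.+1) (f (coord_path y z a.+1) - f (coord_path y z a)).
  rewrite -(big_mkord xpredT (fun k => f (coord_path y z k.+1) - f (coord_path y z k))).
  by rewrite telescope_sumr // coord_path0 coord_path_full.
rewrite -sumrB mulr_sumr; apply: le_trans (ler_norm_sum _ _ _) _.
apply: ler_sum => a _; rewrite coord_pathS.
apply: (increment_step (hd a) (hb a)).
- exact: coord_path_box.
- by rewrite -coord_pathS; apply: coord_path_box.
Qed.

End Boxes.

(** * Boundary derivatives as limits of interior derivatives *)

Section RelativelyOpen.
Context {R : realType} {n : nat}.
Implicit Types (x y z w : 'rV[R]_n.+1) (a b : 'I_n.+1) (e eps : R) (f g : 'rV[R]_n.+1 -> R).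
Implicit Types (U V : set 'rV[R]_n.+1).

Definition rel_open U := U `<=` @half_space R n /\
  forall x, U x -> exists2 e : R, 0 < e & half_box x e `<=` U.

Lemma within_nbhsP U x (P : set 'rV[R]_n.+1) :
  (within U (nbhs x)) P <->
  exists2 d : R, 0 < d & forall y, U y -> `|y - x| < d -> P y.
Proof.
split.
  move=> /nbhs_ballP[d /= d0 h]; exists d => // y Uy yd; apply: h => //.
  by rewrite -ball_normE /= distrC.
move=> [d d0 h]; apply/nbhs_ballP; exists d => // y; rewrite -ball_normE /= => yd Uy.
by apply: h => //; rewrite distrC.
Qed.

Lemma continuous_onP U f : {within U, continuous f} <->
  forall x, U x -> forall e, 0 < e ->
    exists2 d : R, 0 < d & forall y, U y -> `|y - x| < d -> `|f y - f x| < e.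
Proof.
split.
  move=> /subspace_continuousP h x Ux e e0.
  have /cvgrPdist_lt/(_ e e0)/within_nbhsP[d d0 hd] := h x Ux.
  by exists d => // y Uy yd; rewrite distrC; apply: hd.
move=> h; apply/subspace_continuousP => x Ux; apply/cvgrPdist_lt => e e0.
apply/within_nbhsP; have [d d0 hd] := h x Ux e e0.
by exists d => // y Uy yd; rewrite distrC; apply: hd.
Qed.

Lemma continuous_onS U V f : V `<=` U ->
  {within U, continuous f} -> {within V, continuous f}.
Proof. exact: continuous_subspaceW. Qed.

Lemma eq_continuous_on U f g : (forall x, U x -> f x = g x) ->
  {within U, continuous f} -> {within U, continuous g}.
Proof.
move=> fg /continuous_onP h; apply/continuous_onP => x Ux e e0.
have [d d0 hd] := h x Ux e e0; exists d => // y Uy yd.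
by rewrite -!fg //; apply: hd.
Qed.

Lemma push_half_box x e y (d : R) : half_box x e y -> 0 < d ->
  exists2 t : R, 0 < t < d & open_box x e (y + t *: evec ord0).
Proof.
move=> [ye y0] d0; set t := Num.min d (e - `|y - x|) / 2.
have m0 : 0 < Num.min d (e - `|y - x|) by rewrite lt_min d0 subr_gt0.
have m1 : Num.min d (e - `|y - x|) <= d by rewrite ge_min lexx.
have m2 : Num.min d (e - `|y - x|) <= e - `|y - x| by rewrite ge_min lexx orbT.
have t0 : 0 < t by rewrite /t; lra.
exists t; first by apply/andP; split=> //; rewrite /t; lra.
split; last by rewrite shift_coord eqxx mulr1n; move: y0; rewrite /half_space /=; lra.
rewrite addrAC; apply: le_lt_trans (ler_normD _ _) _.
have := norm_scale_evec t (ord0 : 'I_n.+1); rewrite (gtr0_norm t0) /t; lra.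
Qed.

(** Both endpoints are pushed inwards, [increment_open] is applied there, and continuity of [f] lets
    the push tend to zero. No derivative on the boundary is presupposed. *)
Lemma increment_closed x e f (f' : 'I_n.+1 -> 'rV[R]_n.+1 -> R)
    (c : 'I_n.+1 -> R) (eps : R) y z :
  {within half_box x e, continuous f} ->
  (forall a w, open_box x e w -> is_derive w (evec a) f (f' a w)) ->
  (forall a w, open_box x e w -> `|f' a w - c a| <= eps) ->
  half_box x e y -> half_box x e z ->
  `|f z - f y - \sum_a c a * (z 0 a - y 0 a)| <= eps * \sum_a `|z 0 a - y 0 a|.
Proof.
move=> /continuous_onP fc hd hb hy hz; apply/ler_addgt0Pr => eta eta0.
have eta2 : 0 < eta / 2 by rewrite divr_gt0.
have [d1 d10 h1] := fc y hy _ eta2; have [d2 d20 h2] := fc z hz _ eta2.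
have m0 : 0 < Num.min d1 d2 by rewrite lt_min d10.
have [t1 /andP[t10 t1d] ht1] := push_half_box hy m0.
have [t2 /andP[t20 t2d] ht2] := push_half_box hz m0.
(* Both points are pushed by the same [t], so that the differences [z 0 a - y 0 a] do not change. *)
have [t [t0 td hty htz]] : exists t : R, [/\ 0 < t, t < Num.min d1 d2,
    open_box x e (y + t *: evec ord0) & open_box x e (z + t *: evec ord0)].
  have pull w s r : 0 < r -> r <= s -> half_box x e w ->
      open_box x e (w + s *: evec ord0) -> open_box x e (w + r *: evec ord0).
    move=> r0 rs [we w0] [u1 u2]; have e0 : 0 < e by apply: le_lt_trans we.
    split; last first.
      by rewrite shift_coord eqxx mulr1n; move: w0; rewrite /half_space /=; lra.
    apply/row_norm_ltP => // b.
    move/(row_norm_ltP _ e0)/(_ b): we; move/(row_norm_ltP _ e0)/(_ b): u1.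
    rewrite !sub_coord !shift_coord !ltr_norml => /andP[v1 v2] /andP[v3 v4].
    apply/andP; case: (b == ord0) in v1 v2 *;
      rewrite ?mulr1n ?mulr0n in v1 v2 *; split; lra.
  have [t12|t12] := leP t1 t2.
    by exists t1; split=> //; apply: pull ht2.
  by exists t2; split=> //; apply: pull ht1 => //; apply: ltW.
have := increment_open hd hb hty htz.
have E a : (z + t *: evec ord0) 0 a - (y + t *: evec ord0) 0 a = z 0 a - y 0 a.
  by rewrite !shift_coord opprD addrACA subrr addr0.
under eq_bigr do rewrite E; under [X in _ <= _ * X]eq_bigr do rewrite E.
have nt w : `|w + t *: evec ord0 - w| < Num.min d1 d2.
  rewrite [w + _]addrC addrK; apply: le_lt_trans (norm_scale_evec _ _) _.
  by rewrite gtr0_norm.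
have {}h1 : `|f (y + t *: evec ord0) - f y| < eta / 2.
  by apply: h1; [exact: open_half_box|apply: lt_le_trans (nt y) _; rewrite ge_min lexx].
have {}h2 : `|f (z + t *: evec ord0) - f z| < eta / 2.
  by apply: h2; [exact: open_half_box|
    apply: lt_le_trans (nt z) _; rewrite ge_min lexx orbT].
set s1 := \sum_a _; set s2 := \sum_a _; move: h1 h2.
rewrite !ltr_norml !ler_norml => /andP[? ?] /andP[? ?] /andP[? ?].
apply/andP; split; lra.
Qed.

Lemma continuous_on_family U (I : finType) (g : I -> 'rV[R]_n.+1 -> R) x e :
  (forall i, {within U, continuous (g i)}) -> U x -> 0 < e ->
  exists2 d : R, 0 < d &
    forall i y, U y -> `|y - x| < d -> `|g i y - g i x| < e.
Proof.
move=> gc Ux e0.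
have : \forall y \near within U (nbhs x), forall i, `|g i y - g i x| < e.
  apply: filter_forall => a; apply/within_nbhsP.
  by have /continuous_onP/(_ x Ux e e0) := gc a.
by move=> /within_nbhsP[d d0 h]; exists d => // a y Uy yd; apply: h.
Qed.

(** Strict differentiability at [x], boundary points included, with the continuous extensions [f' a]
    of the interior derivatives as coefficients. *)
Lemma C1_estimate U f (f' : 'I_n.+1 -> 'rV[R]_n.+1 -> R) x eps :
  rel_open U -> {within U, continuous f} ->
  (forall a, {within U, continuous (f' a)}) ->
  (forall a y, U y -> 0 < y 0 ord0 -> is_derive y (evec a) f (f' a y)) ->
  U x -> 0 < eps ->
  exists2 d : R, 0 < d & half_box x d `<=` U /\
    forall y z, half_box x d y -> half_box x d z ->
    `|f z - f y - \sum_a f' a x * (z 0 a - y 0 a)| <= eps * \sum_a `|z 0 a - y 0 a|.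
Proof.
move=> [UH Uo] fc f'c fd Ux e0.
have [d1 d10 h1] := Uo x Ux; have [d2 d20 h2] := continuous_on_family f'c Ux e0.
have m1 : Num.min d1 d2 <= d1 by rewrite ge_min lexx.
have m2 : Num.min d1 d2 <= d2 by rewrite ge_min lexx orbT.
have sub : half_box x (Num.min d1 d2) `<=` U.
  by move=> y [y1 y2]; apply: h1; split=> //; apply: lt_le_trans m1.
exists (Num.min d1 d2); first by rewrite lt_min d10.
split=> // y z hy hz; apply: (@increment_closed x (Num.min d1 d2) f f') => //.
- exact: continuous_onS fc.
- by move=> a w [w1 w2]; apply: fd => //; apply: sub; apply: open_half_box.
- move=> a w [w1 w2]; apply: ltW; apply: h2; last exact: lt_le_trans m2.
  by apply: sub; apply: open_half_box.
Qed.

Lemma pd_filter_filter a x : Filter (@pd_filter R n a x).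
Proof. exact: within_filter. Qed.

Lemma pd_filterP a x (P : set R) : pd_filter a x P <->
  exists2 d : R, 0 < d & forall t, `|t| < d -> t != 0 ->
    half_space (x + t *: evec a) -> P t.
Proof.
split.
  move=> /nbhs_ballP[d /= d0 h]; exists d => // t td t0 ht; apply: h => //.
  by rewrite -ball_normE /= sub0r normrN.
move=> [d d0 h]; apply/nbhs_ballP; exists d => // t; rewrite -ball_normE /= sub0r normrN.
by move=> td t0 ht; apply: h.
Qed.

Lemma pd_filter_proper a x : half_space x -> ProperFilter (@pd_filter R n a x).
Proof.
move=> hx; have FF := pd_filter_filter a x; apply: Build_ProperFilter_ex.
move=> P /pd_filterP[d d0 h]; exists (d / 2); apply: h.
- by rewrite gtr0_norm; lra.
- by apply/eqP; lra.
- move: hx; rewrite /half_space /= shift_coord.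
  by case: (_ == _); rewrite ?mulr0n ?mulr1n; lra.
Qed.

Lemma pd_limit a f x l : half_space x ->
  pd_quotient a f x @ pd_filter a x --> l -> has_pd a f x /\ pd a f x = l.
Proof.
move=> hx h; have := pd_filter_proper a hx => ?; split; first by apply/cvg_ex; exists l.
exact: cvg_lim h.
Qed.

(** This is [C1_estimate] between [x] and [x + t *: evec a], where only the term of index [a]
    survives, divided by [t]. *)
Lemma C1_pd U f (f' : 'I_n.+1 -> 'rV[R]_n.+1 -> R) :
  rel_open U -> {within U, continuous f} ->
  (forall a, {within U, continuous (f' a)}) ->
  (forall a y, U y -> 0 < y 0 ord0 -> is_derive y (evec a) f (f' a y)) ->
  forall a x, U x -> has_pd a f x /\ pd a f x = f' a x.
Proof.
move=> Uo fc f'c fd a x Ux; have hx : half_space x by apply: Uo.1.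
apply: pd_limit => //; apply/cvgrPdist_le => eps e0.
have [d d0 [sub h]] := C1_estimate Uo fc f'c fd Ux e0.
apply/pd_filterP; exists d => // t td t0 ht.
have := h x (x + t *: evec a).
have S1 : \sum_b f' b x * ((x + t *: evec a) 0 b - x 0 b) = f' a x * t.
  rewrite (bigD1 a) //= big1 => [|b /negPf ba]; rewrite shift_coord addrAC subrr add0r.
    by rewrite eqxx mulr1n addr0.
  by rewrite ba mulr0n mulr0.
have S2 : \sum_b `|(x + t *: evec a) 0 b - x 0 b| = `|t|.
  rewrite (bigD1 a) //= big1 => [|b /negPf ba]; rewrite shift_coord addrAC subrr add0r.
    by rewrite eqxx mulr1n addr0.
  by rewrite ba mulr0n normr0.
rewrite S1 S2 => H.
have {}H : `|f (x + t *: evec a) - f x - f' a x * t| <= eps * `|t|.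
  apply: H; split=> //; first by rewrite subrr normr0.
  by rewrite [x + _]addrC addrK; apply: le_lt_trans (norm_scale_evec _ _) td.
have nt : 0 < `|t| by rewrite normr_gt0.
rewrite -(ler_pM2r nt) distrC -normrM /pd_quotient -/(evec a).
by rewrite mulrBl mulrAC mulVf // mul1r.
Qed.

Lemma pd_filter_interior a x : 0 < x 0 ord0 -> pd_filter a x = 0^'.
Proof.
move=> x0; apply/funext => P; apply/propext; split; last first.
  by rewrite /pd_filter /within /= => hP; apply: filterS hP.
move=> /pd_filterP[d d0 hP]; apply/nbhs_ballP.
exists (Num.min d (x 0 ord0)); first by rewrite /= lt_min d0.
move=> t; rewrite -ball_normE /= sub0r normrN lt_min => /andP[td tx] t0.
apply: hP => //; rewrite /half_space /= shift_coord.
move: tx; rewrite ltr_norml => /andP[? ?].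
by case: (_ == _); rewrite ?mulr0n ?mulr1n; lra.
Qed.

Lemma pd_quotientE a f x : pd_quotient a f x =
  (fun t : R => t^-1 *: ((f \o shift x) (t *: evec a) - f x)).
Proof. by apply/funext => t; rewrite /pd_quotient /= [x + _]addrC. Qed.

Lemma is_derive_pd a f x : 0 < x 0 ord0 -> has_pd a f x ->
  is_derive x (evec a) f (pd a f x).
Proof.
move=> x0; have E := pd_filter_interior a x0; have Q := pd_quotientE a f x.
by rewrite /pd /has_pd E Q => h; split.
Qed.

Lemma pd_val a f x d : 0 < x 0 ord0 -> is_derive x (evec a) f d -> pd a f x = d.
Proof. by move=> x0 [_ <-]; rewrite /pd pd_filter_interior // pd_quotientE. Qed.

End RelativelyOpen.

(** * Functions smooth up to the boundary *)

Section SmoothFunctions.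
Context {R : realType} {n : nat}.
Implicit Types (x y z w : 'rV[R]_n.+1) (a b : 'I_n.+1) (f g : 'rV[R]_n.+1 -> R).
Implicit Types (U V : set 'rV[R]_n.+1) (B : ('rV[R]_n.+1 -> R) -> Prop).

Lemma interior_near U x : rel_open U -> U x -> 0 < x 0 ord0 ->
  \forall y \near x, U y /\ 0 < y 0 ord0.
Proof.
move=> [_ Uo] Ux x0; have [e e0 he] := Uo x Ux.
apply/nbhs_ballP; exists (Num.min e (x 0 ord0)); first by rewrite /= lt_min e0.
move=> y; rewrite -ball_normE /= distrC lt_min => /andP[ye yx].
have := le_lt_trans (coord_le_norm (y - x) ord0) yx.
rewrite sub_coord ltr_norml => /andP[? ?].
have y0 : 0 < y 0 ord0 by lra.
by split=> //; apply: he; split=> //; apply: ltW.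
Qed.

Lemma Ck_onS k U V f : V `<=` U -> Ck_on k U f -> Ck_on k V f.
Proof.
elim: k f => [|k IH] f VU /= [fc h]; (split; first exact: continuous_onS fc); try by [].
move=> a; have [h1 h2] := h a; split; last exact: IH.
by move=> x /VU; apply: h1.
Qed.

Lemma Cinfty_onS U V f : V `<=` U -> Cinfty_on U f -> Cinfty_on V f.
Proof. by move=> VU h k; apply: Ck_onS (h k). Qed.

Lemma Cinfty_continuous U f : Cinfty_on U f -> {within U, continuous f}.
Proof. by move=> /(_ 0%N) []. Qed.

Lemma Cinfty_has_pd U f a x : Cinfty_on U f -> U x -> has_pd a f x.
Proof. by move=> /(_ 1%N) [_ /(_ a) [h _]]; apply: h. Qed.

Lemma Cinfty_pd U f a : Cinfty_on U f -> Cinfty_on U (pd a f).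
Proof. by move=> h k; have [_ /(_ a) []] := h k.+1. Qed.

Lemma Cinfty_is_derive U f a x : Cinfty_on U f -> U x -> 0 < x 0 ord0 ->
  is_derive x (evec a) f (pd a f x).
Proof. by move=> hf Ux x0; apply: is_derive_pd => //; apply: Cinfty_has_pd hf Ux. Qed.

Lemma eq_pd_cvg U f g a x : rel_open U -> U x -> (forall y, U y -> f y = g y) ->
  pd_quotient a f x @ pd_filter a x = pd_quotient a g x @ pd_filter a x.
Proof.
move=> [_ Uo] Ux fg; have [e e0 he] := Uo x Ux.
have FF := pd_filter_filter a x.
have N : \forall t \near pd_filter a x, pd_quotient a f x t = pd_quotient a g x t.
  apply/pd_filterP; exists e => // t te t0 ht; rewrite /pd_quotient !fg //.
  apply: he; split=> //; rewrite [x + _]addrC addrK.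
  exact: le_lt_trans (norm_scale_evec _ _) te.
apply/seteqP; split; apply: near_eq_cvg => //.
by near do apply/esym.
Unshelve. all: by end_near. Qed.

Lemma eq_pd U f g a x : rel_open U -> U x -> (forall y, U y -> f y = g y) ->
  pd a f x = pd a g x.
Proof. by move=> Uo Ux fg; rewrite /pd (eq_pd_cvg a Uo Ux fg). Qed.

Lemma eq_Ck_on k U f g : rel_open U -> (forall x, U x -> f x = g x) ->
  Ck_on k U f -> Ck_on k U g.
Proof.
move=> Uo; elim: k f g => [|k IH] f g fg /= [fc h]; 
  (split; first exact: eq_continuous_on fg fc); try by [].
move=> a; have [h1 h2] := h a; split.
  by move=> x Ux; rewrite /has_pd -(eq_pd_cvg a Uo Ux fg); apply: h1.
by apply: IH h2 => x Ux; apply: eq_pd fg.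
Qed.

Lemma eq_Cinfty_on U f g : rel_open U -> (forall x, U x -> f x = g x) ->
  Cinfty_on U f -> Cinfty_on U g.
Proof. by move=> Uo fg h k; apply: eq_Ck_on fg (h k). Qed.

Lemma Cinfty_local U f : U `<=` @half_space R n ->
  (forall x, U x -> exists V, [/\ rel_open V, V x & Cinfty_on V f]) ->
  Cinfty_on U f.
Proof.
move=> UH h k.
have {}h x : U x -> exists V, [/\ rel_open V, V x & Ck_on k V f].
  by move=> /h[V [h1 h2 h3]]; exists V; split.
have cont k' f' : (forall x, U x -> exists V, [/\ rel_open V, V x & Ck_on k' V f']) ->
    {within U, continuous f'}.
  move=> {}h; apply/continuous_onP => x Ux e e0.
  have [V [[_ Vo] Vx hV]] := h x Ux.
  have /continuous_onP/(_ x Vx e e0)[d d0 hd] : {within V, continuous f'}.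
    by case: (k') hV => [|?] [].
  have [r r0 hr] := Vo x Vx; exists (Num.min d r); first by rewrite lt_min d0.
  move=> y Uy; rewrite lt_min => /andP[yd yr]; apply: hd => //.
  by apply: hr; split=> //; apply: UH.
elim: k f h => [|k IH] f h; split; try exact: cont h; first by [].
move=> a; split; first by move=> x /h[V [_ Vx [_ /(_ a)[hV _]]]]; apply: hV.
by apply: IH => x /h[V [Vo Vx [_ /(_ a)[_ hV]]]]; exists V.
Qed.

(** [B] is a family of generators. With [alg_ext], membership depends only on the values on [U], so
    formulas may be rewritten there. *)
Inductive alg_closure B U : ('rV[R]_n.+1 -> R) -> Prop :=
| alg_base f of B f : alg_closure B U f
| alg_cst (c : R) : alg_closure B U (fun=> c)
| alg_add f g of alg_closure B U f & alg_closure B U g :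
    alg_closure B U (fun x => f x + g x)
| alg_mul f g of alg_closure B U f & alg_closure B U g :
    alg_closure B U (fun x => f x * g x)
| alg_inv f of alg_closure B U f & (forall x, U x -> f x != 0) :
    alg_closure B U (fun x => (f x)^-1)
| alg_ext f g of alg_closure B U f & (forall x, U x -> f x = g x) :
    alg_closure B U g.

Lemma alg_opp B U f : alg_closure B U f -> alg_closure B U (fun x => - f x).
Proof.
move=> hf; apply: (alg_ext (alg_mul (alg_cst _ _ (-1)) hf)) => x _.
by rewrite mulN1r.
Qed.

Lemma alg_sum B U (I : Type) (r : seq I) (P : pred I) (F : I -> 'rV[R]_n.+1 -> R) :
  (forall i, P i -> alg_closure B U (F i)) ->
  alg_closure B U (fun x => \sum_(i <- r | P i) F i x).
Proof.
move=> hF; elim: r => [|i r IH].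
  by apply: (alg_ext (alg_cst _ _ 0)) => x _; rewrite big_nil.
case Pi: (P i).
  by apply: (alg_ext (alg_add (hF _ Pi) IH)) => x _; rewrite big_cons Pi.
by apply: (alg_ext IH) => x _; rewrite big_cons Pi.
Qed.

Lemma is_derive_inv f x v (d : R) : f x != 0 -> is_derive x v f d ->
  is_derive x v (fun y => (f y)^-1) (- ((f x)^-1 * (f x)^-1) * d).
Proof.
move=> f0 [d1 d2]; split; first exact: derivableV.
by rewrite deriveV // d2 -invfM -expr2.
Qed.

(** * Smoothness from closure under interior differentiation *)

Section Closure.
Variables (B : ('rV[R]_n.+1 -> R) -> Prop) (U : set 'rV[R]_n.+1).
Hypothesis Uo : rel_open U.
Hypothesis B_continuous : forall f, B f -> {within U, continuous f}.
Hypothesis B_derive : forall f a, B f -> exists2 f', alg_closure B U f' &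
  forall x, U x -> 0 < x 0 ord0 -> is_derive x (evec a) f (f' x).

Lemma alg_continuous f : alg_closure B U f -> {within U, continuous f}.
Proof.
elim=> {f}.
- exact: B_continuous.
- by move=> c; apply/continuous_onP => x _ e e0; exists 1 => // y _ _; rewrite subrr normr0.
- move=> f g _ /subspace_continuousP hf _ /subspace_continuousP hg.
  by apply/subspace_continuousP => x Ux; apply: cvgD; [apply: hf|apply: hg].
- move=> f g _ /subspace_continuousP hf _ /subspace_continuousP hg.
  by apply/subspace_continuousP => x Ux; apply: cvgM; [apply: hf|apply: hg].
- move=> f _ /subspace_continuousP hf f0.
  by apply/subspace_continuousP => x Ux; apply: cvgV; [apply: f0|apply: hf].
- by move=> f g _ hf fg; apply: eq_continuous_on hf.
Qed.

Lemma alg_derive f a : alg_closure B U f -> exists2 f', alg_closure B U f' &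
  forall x, U x -> 0 < x 0 ord0 -> is_derive x (evec a) f (f' x).
Proof.
elim=> {f}.
- by move=> f; apply: B_derive.
- by move=> c; exists (fun=> 0); [apply: alg_cst|move=> x _ _; apply: is_derive_cst].
- move=> f g _ [f' hf' df] _ [g' hg' dg].
  exists (fun x => f' x + g' x); first exact: alg_add.
  by move=> x Ux x0; apply: is_deriveD; [apply: df|apply: dg].
- move=> f g hf [f' hf' df] hg [g' hg' dg].
  exists (fun x => f x * g' x + g x * f' x).
    by apply: alg_add; apply: alg_mul.
  by move=> x Ux x0; apply: is_deriveM; [apply: df|apply: dg].
- move=> f hf [f' hf' df] f0.
  exists (fun x => - ((f x)^-1 * (f x)^-1) * f' x).
    by apply: alg_mul => //; apply: alg_opp; apply: alg_mul; apply: alg_inv.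
  by move=> x Ux x0; apply: is_derive_inv; [apply: f0|apply: df].
- move=> f g _ [f' hf' df] fg; exists f' => // x Ux x0.
  apply: near_eq_is_derive (df x Ux x0).
  by near do apply: fg; have := interior_near Uo Ux x0; apply: filterS => y [].
Unshelve. all: by end_near. Qed.

(** Induction on the order: by [C1_pd] each partial derivative agrees on all of [U] with an element
    of the closure, to which the induction hypothesis applies. *)
Lemma alg_Cinfty f : alg_closure B U f -> Cinfty_on U f.
Proof.
move=> hf k; elim: k f hf => [|k IH] f hf; split=> //; try exact: alg_continuous.
have /choice[f' hf'] a : exists f', alg_closure B U f' /\
    forall x, U x -> 0 < x 0 ord0 -> is_derive x (evec a) f (f' x).
  by have [f' h1 h2] := alg_derive a hf; exists f'.
have h a x := C1_pd Uo (alg_continuous hf)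
  (fun a => alg_continuous (hf' a).1) (fun a => (hf' a).2) a (x := x).
move=> a; split; first by move=> x /(h a)[].
apply: (eq_Ck_on (f := f' a)) => //; last by apply: IH; apply: (hf' a).1.
by move=> x /(h a)[].
Qed.

End Closure.

Lemma Cinfty_alg U f : rel_open U -> alg_closure (Cinfty_on U) U f -> Cinfty_on U f.
Proof.
move=> Uo; apply: alg_Cinfty => // {}f; first exact: Cinfty_continuous.
move=> a hf; exists (pd a f); first by apply: alg_base; apply: Cinfty_pd.
by move=> x Ux x0; apply: Cinfty_is_derive Ux x0.
Qed.

Section Rules.
Variables (U : set 'rV[R]_n.+1).
Hypothesis Uo : rel_open U.

Lemma Cinfty_cst (c : R) : Cinfty_on U (fun=> c).
Proof. by apply: Cinfty_alg => //; apply: alg_cst. Qed.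

Lemma CinftyD f g : Cinfty_on U f -> Cinfty_on U g -> Cinfty_on U (fun x => f x + g x).
Proof. by move=> hf hg; apply: Cinfty_alg => //; apply: alg_add; apply: alg_base. Qed.

Lemma CinftyM f g : Cinfty_on U f -> Cinfty_on U g -> Cinfty_on U (fun x => f x * g x).
Proof. by move=> hf hg; apply: Cinfty_alg => //; apply: alg_mul; apply: alg_base. Qed.

Lemma CinftyV f : (forall x, U x -> f x != 0) -> Cinfty_on U f ->
  Cinfty_on U (fun x => (f x)^-1).
Proof. by move=> f0 hf; apply: Cinfty_alg => //; apply: alg_inv => //; apply: alg_base. Qed.

Lemma CinftyN f : Cinfty_on U f -> Cinfty_on U (fun x => - f x).
Proof. by move=> hf; apply: Cinfty_alg => //; apply: alg_opp; apply: alg_base. Qed.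

Lemma CinftyB f g : Cinfty_on U f -> Cinfty_on U g -> Cinfty_on U (fun x => f x - g x).
Proof. by move=> hf hg; apply: CinftyD => //; apply: CinftyN. Qed.

Lemma Cinfty_sum (I : Type) (r : seq I) (P : pred I) (F : I -> 'rV[R]_n.+1 -> R) :
  (forall i, P i -> Cinfty_on U (F i)) ->
  Cinfty_on U (fun x => \sum_(i <- r | P i) F i x).
Proof.
by move=> hF; apply: Cinfty_alg => //; apply: alg_sum => i Pi; apply/alg_base/hF.
Qed.

Lemma Cinfty_prod (I : Type) (r : seq I) (P : pred I) (F : I -> 'rV[R]_n.+1 -> R) :
  (forall i, P i -> Cinfty_on U (F i)) ->
  Cinfty_on U (fun x => \prod_(i <- r | P i) F i x).
Proof.
move=> hF; elim: r => [|i r IH].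
  by apply: eq_Cinfty_on (Cinfty_cst 1) => // x _; rewrite big_nil.
case Pi: (P i).
  by apply: eq_Cinfty_on (CinftyM (hF _ Pi) IH) => // x _; rewrite big_cons Pi.
by apply: eq_Cinfty_on IH => // x _; rewrite big_cons Pi.
Qed.

Lemma CinftyX f k : Cinfty_on U f -> Cinfty_on U (fun x => f x ^+ k).
Proof.
move=> hf; elim: k => [|k IH]; first exact: Cinfty_cst.
by apply: eq_Cinfty_on (CinftyM hf IH) => // x _; rewrite exprS.
Qed.

Lemma Cinfty_det k (M : 'rV[R]_n.+1 -> 'M[R]_k) :
  (forall i j, Cinfty_on U (fun x => M x i j)) -> Cinfty_on U (fun x => \det (M x)).
Proof.
move=> hM; apply: Cinfty_sum => s _; apply: CinftyM; first exact: Cinfty_cst.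
by apply: Cinfty_prod => i _; apply: hM.
Qed.

Lemma Cinfty_invmx k (M : 'rV[R]_n.+1 -> 'M[R]_k) :
  (forall i j, Cinfty_on U (fun x => M x i j)) ->
  (forall x, U x -> M x \in unitmx) ->
  forall i j, Cinfty_on U (fun x => invmx (M x) i j).
Proof.
move=> hM Mu i j.
(* Cramer's rule: the entries of the inverse are cofactors divided by the determinant. *)
apply: (eq_Cinfty_on (f := fun x => (\det (M x))^-1 *
    ((-1) ^+ (j + i) * \det (row' j (col' i (M x)))))) => //.
  by move=> x Ux; rewrite /invmx (Mu x Ux) !mxE.
apply: CinftyM.
  apply: CinftyV; last exact: Cinfty_det.
  by move=> x /Mu; rewrite unitmxE unitfE.
apply: CinftyM; first exact: Cinfty_cst.
apply: Cinfty_det => i' j'; apply: (eq_Cinfty_on (f := fun x => M x (lift j i') (lift i j'))) => //.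
by move=> x _; rewrite !mxE.
Qed.

Lemma is_derive_coord a b x : is_derive x (evec a) (fun y => y 0 b) ((b == a)%:R : R).
Proof.
have h : derivable (fun y : 'rV[R]_n.+1 => y) x (evec a) by apply: derivable_id.
split; first by have /derivable_mxP := h; apply.
have := derive_mx h; rewrite derive_id => /matrixP/(_ 0 b).
by rewrite !mxE eqxx /= => <-.
Qed.

Lemma Cinfty_coord b : Cinfty_on U (fun x => x 0 b).
Proof.
apply: (@alg_Cinfty (fun f => f = (fun x => x 0 b))) => //; last exact: alg_base.
  move=> _ ->; apply/continuous_onP => x _ e e0; exists e => // y _.
  by apply: le_lt_trans; rewrite -sub_coord; apply: coord_le_norm.
move=> _ a ->; exists (fun=> (b == a)%:R); first exact: alg_cst.
by move=> x _ _; apply: is_derive_coord.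
Qed.

Lemma Cinfty_estimate f x eps : Cinfty_on U f -> U x -> 0 < eps ->
  exists2 d : R, 0 < d & half_box x d `<=` U /\
    forall y z, half_box x d y -> half_box x d z ->
    `|f z - f y - \sum_a pd a f x * (z 0 a - y 0 a)| <=
      eps * \sum_a `|z 0 a - y 0 a|.
Proof.
move=> hf Ux e0; apply: (C1_estimate (f' := fun a => pd a f)) => //.
- exact: Cinfty_continuous.
- by move=> a; apply/Cinfty_continuous/Cinfty_pd.
- by move=> a y Uy y0; apply: Cinfty_is_derive hf Uy y0.
Qed.

End Rules.

End SmoothFunctions.

(** * The chain rule and the symmetry of second derivatives *)

Section ChainRule.
Context {R : realType} {n : nat}.
Implicit Types (x y z w v : 'rV[R]_n.+1) (a b c : 'I_n.+1).
Implicit Types (f F : 'rV[R]_n.+1 -> R) (U V : set 'rV[R]_n.+1).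

Lemma is_derive_cvg (E : normedModType R) (f : E -> R) (x v : E) l :
  (fun h : R => h^-1 *: ((f \o shift x) (h *: v) - f x)) @ 0^' --> l ->
  is_derive x v f l.
Proof.
by move=> h; split; [apply/cvg_ex; exists l|rewrite /derive; apply: cvg_lim h].
Qed.

Lemma cvg_is_derive (E : normedModType R) (f : E -> R) (x v : E) l : is_derive x v f l ->
  (fun h : R => h^-1 *: ((f \o shift x) (h *: v) - f x)) @ 0^' --> l.
Proof. by case=> h <-. Qed.

Lemma is_derive1_comp (phi g : R -> R) (t d d' : R) :
  is_derive t 1 phi d -> is_derive (phi t) 1 g d' ->
  is_derive t 1 (g \o phi) (d' * d).
Proof.
move=> [f1 f2] [g1 g2]; split.
  apply/derivable1_diffP; apply: differentiable_comp.
    by apply/derivable1_diffP.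
  by apply/derivable1_diffP.
have := derive1_comp f1 g1; rewrite derive1E => ->.
by rewrite derive1E g2 derive1E f2.
Qed.

Lemma is_derive_comp1 (f : 'rV[R]_n.+1 -> R) (g : R -> R) x v d d' :
  is_derive x v f d -> is_derive (f x) 1 g d' ->
  is_derive x v (fun y => g (f y)) (d' * d).
Proof.
move=> hf hg.
have h1 : is_derive (0 : R) 1 (fun s : R => f (x + s *: v)) d.
  by apply: is_derive_slice; rewrite scale0r addr0.
have h2 : is_derive (f (x + 0 *: v)) 1 g d' by rewrite scale0r addr0.
have /cvg_is_derive H := is_derive1_comp h1 h2.
apply: is_derive_cvg; move: H; rewrite (_ : (fun _ => _) =
  (fun h : R => h^-1 *: (((fun y => g (f y)) \o shift x) (h *: v) - g (f x)))) //.
apply/funext => h /=; congr (_ *: (g (f _) - g (f _))).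
  by rewrite addr0 [h *: 1]mulr1 [_ + x]addrC.
by rewrite scale0r addr0.
Qed.

Lemma is_derive_bigsum (I : Type) (r : seq I) (P : pred I)
    (F : I -> 'rV[R]_n.+1 -> R) (d : I -> R) x v :
  (forall i, P i -> is_derive x v (F i) (d i)) ->
  is_derive x v (fun y => \sum_(i <- r | P i) F i y) (\sum_(i <- r | P i) d i).
Proof.
move=> h; elim: r => [|i r IH].
  rewrite big_nil (_ : (fun _ => _) = cst 0); first exact: is_derive_cst.
  by apply/funext => y; rewrite big_nil.
rewrite big_cons; case Pi: (P i).
  rewrite (_ : (fun _ => _) = (fun y => F i y + \sum_(i <- r | P i) F i y)).
    by apply: is_deriveD => //; apply: h.
  by apply/funext => y; rewrite big_cons Pi.
rewrite (_ : (fun _ => _) = (fun y => \sum_(i <- r | P i) F i y)) //.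
by apply/funext => y; rewrite big_cons Pi.
Qed.

(** The point [phi x] may lie on the hyperplane, where [F] has only one-sided normal derivatives.
    [Cinfty_estimate] remains valid there because both [phi x] and [phi (x + h *: evec a)] lie in
    the half-space. *)
Lemma chain_rule U V F (phi : 'rV[R]_n.+1 -> 'rV[R]_n.+1) (d : 'I_n.+1 -> R) a x :
  rel_open U -> rel_open V -> (forall y, U y -> V (phi y)) -> Cinfty_on V F ->
  U x -> 0 < x 0 ord0 ->
  (forall c, is_derive x (evec a) (fun y => phi y 0 c) (d c)) ->
  is_derive x (evec a) (F \o phi) (\sum_c pd c F (phi x) * d c).
Proof.
move=> Uo Vo UV hF Ux x0 hd; apply: is_derive_cvg.
pose q c (h : R) := h^-1 * (phi (x + h *: evec a) 0 c - phi x 0 c).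
have qd c : q c @ 0^' --> d c.
  have := cvg_is_derive (hd c); rewrite (_ : (fun _ => _) = q c) //.
  by apply/funext => h; rewrite /q /= [x + _]addrC.
(* [K] bounds the sum of the difference quotients of the components of [phi]. Hence precision
   [eps / (2 * K)] for [F] leaves an error of at most [eps / 2], and [|h| < r / K] keeps the image
   point in the box of radius [r]. *)
pose K : R := \sum_c `|d c| + 1.
have K0 : 0 < K by rewrite ltr_wpDl // sumr_ge0.
have qK : \forall h \near 0^', \sum_c `|q c h| < K.
  have : (fun h => \sum_c `|q c h|) @ 0^' --> \sum_c `|d c|.
    by apply: cvg_big => [|c _]; [exact: add_continuous|apply: cvg_norm].
  by move=> /cvgr_lt; apply; rewrite /K ltrDl.
have ql : (fun h => \sum_c pd c F (phi x) * q c h) @ 0^' --> \sum_c pd c F (phi x) * d c.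
  by apply: cvg_big => [|c _]; [exact: add_continuous|apply: cvgMr].
apply/cvgrPdist_le => eps e0; have K2 : 0 < 2 * K by rewrite mulr_gt0.
have Vx : V (phi x) by apply: UV.
have [r r0 [rV hr]] := Cinfty_estimate Vo hF Vx (divr_gt0 e0 K2).
have inU : \forall h \near 0^', U (x + h *: evec a).
  have [t t0 ht] := Uo.2 x Ux.
  apply/nbhs_ballP; exists (Num.min t (x 0 ord0)); first by rewrite /= lt_min t0.
  move=> h; rewrite -ball_normE /= sub0r normrN lt_min => /andP[h1 h2] _.
  apply: ht; split.
    by rewrite [x + _]addrC addrK; apply: le_lt_trans (norm_scale_evec _ _) h1.
  rewrite /half_space /= shift_coord; move: h2; rewrite ltr_norml => /andP[? ?].
  by case: (_ == _); rewrite ?mulr0n ?mulr1n; lra.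
near=> h.
have h0 : h != 0 by near: h; exact: nbhs_dnbhs_neq.
have hU : U (x + h *: evec a) by near: h.
have hK : \sum_c `|q c h| < K by near: h.
have hl : `|\sum_c pd c F (phi x) * d c - \sum_c pd c F (phi x) * q c h| <= eps / 2.
  by near: h; move/cvgrPdist_le : ql; apply; rewrite divr_gt0.
have hr' : `|h| < r / K.
  by near: h; apply: dnbhs0_lt; rewrite divr_gt0.
have dq c : phi (x + h *: evec a) 0 c - phi x 0 c = h * q c h.
  by rewrite /q mulrA mulfV // mul1r.
have hb : half_box (phi x) r (phi (x + h *: evec a)).
  split; last by apply: Vo.1; apply: UV.
  apply/row_norm_ltP => // c; rewrite sub_coord dq normrM.
  rewrite ltr_pdivlMr // in hr'; apply: le_lt_trans hr'; apply: ler_wpM2l => //.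
  apply: le_trans (ltW hK); rewrite (bigD1 c) //= lerDl; apply: sumr_ge0 => //.
have hx : half_box (phi x) r (phi x).
  by split; [rewrite subrr normr0|apply: Vo.1].
have := hr _ _ hx hb; under eq_bigr do rewrite dq.
under [X in _ <= _ * X -> _]eq_bigr do rewrite dq normrM.
rewrite -mulr_sumr => H.
rewrite /= [h *: _ + x]addrC.
have nh : 0 < `|h| by rewrite normr_gt0.
have {}H : `|h^-1 * (F (phi (x + h *: evec a)) - F (phi x)) -
    \sum_c pd c F (phi x) * q c h| <= eps / 2.
  rewrite -(ler_pM2l nh) -normrM mulrBr mulrA mulfV // mul1r mulr_sumr.
  under eq_bigr do rewrite mulrCA.
  apply: le_trans H _; rewrite mulrCA; apply: ler_wpM2l => //.
  rewrite mulrAC ler_pdivrMr // (_ : eps / 2 * (2 * K) = eps * K); last by field.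
  by rewrite ler_wpM2l // ltW.
move: H hl; rewrite !ler_norml => /andP[? ?] /andP[? ?].
rewrite -[_ *: _]/(h^-1 * (F (phi (x + h *: evec a)) - F (phi x))).
by apply/andP; split; lra.
Unshelve. all: by end_near. Qed.

(** The generators are the smooth functions on [U] and the pull-backs of smooth functions on [V];
    the chain rule keeps interior derivatives in their algebra. *)
Lemma Cinfty_comp U V F (phi : 'rV[R]_n.+1 -> 'rV[R]_n.+1) :
  rel_open U -> rel_open V -> (forall y, U y -> V (phi y)) -> Cinfty_on V F ->
  (forall c, Cinfty_on U (fun y => phi y 0 c)) -> Cinfty_on U (F \o phi).
Proof.
move=> Uo Vo UV hF hphi.
apply: (@alg_Cinfty _ _ (fun f => Cinfty_on U f \/
    exists2 G, Cinfty_on V G & f = G \o phi)) => //; last first.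
- by apply: alg_base; right; exists F.
- move=> f a [hf|[G hG ->]].
    exists (pd a f); first by apply: alg_base; left; apply: Cinfty_pd.
    by move=> x Ux x0; apply: Cinfty_is_derive Ux x0.
  exists (fun x => \sum_c pd c G (phi x) * pd a (fun y => phi y 0 c) x).
    apply: alg_sum => c _; apply: alg_mul; apply: alg_base.
      by right; exists (pd c G) => //; apply: Cinfty_pd.
    by left; apply: Cinfty_pd.
  move=> x Ux x0; apply: (chain_rule Uo Vo UV hG Ux x0) => c.
  exact: Cinfty_is_derive (hphi c) Ux x0.
- move=> f [/Cinfty_continuous //|[G /Cinfty_continuous/continuous_onP hG ->]].
  apply/continuous_onP => x Ux e e0.
  have [d d0 hd] := hG _ (UV _ Ux) e e0.
  have [t t0 ht] := continuous_on_family (fun c => Cinfty_continuous (hphi c)) Ux d0.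
  exists t => // y Uy yt; apply: hd; first exact: UV.
  by apply/row_norm_ltP => // c; rewrite sub_coord; apply: ht.
Qed.

Lemma second_difference_bound (A B C D p q eps s : R) : 0 < s ->
  `|A - B - (C - D) - p * s * s| <= eps / 2 * s * s ->
  `|A - C - (B - D) - q * s * s| <= eps / 2 * s * s -> `|p - q| <= eps.
Proof.
move=> s0; rewrite ler_norml => /andP[h1 h2]; rewrite ler_norml => /andP[h3 h4].
have ss : 0 < s * s by rewrite mulr_gt0.
have E1 : p * s * s = p * (s * s) by rewrite mulrA.
have E2 : q * s * s = q * (s * s) by rewrite mulrA.
have E3 : eps / 2 * s * s = eps * (s * s) / 2 by field.
rewrite E1 E3 in h1 h2; rewrite E2 E3 in h3 h4.
by rewrite ler_norml; apply/andP; split; rewrite -(ler_pM2r ss); lra.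
Qed.

(** Both mixed derivatives approximate the same second difference of [f], divided by [s * s], to
    within [eps / 2]. *)
Lemma iterated_pd_comm U f a b x : rel_open U -> Cinfty_on U f ->
  U x -> 0 < x 0 ord0 -> pd a (pd b f) x = pd b (pd a f) x.
Proof.
move=> Uo hf Ux x0; apply/eqP; rewrite -subr_eq0 -normr_le0.
apply/ler_addgt0Pr => eps e0; rewrite add0r.
have e2 : 0 < eps / 2 by rewrite divr_gt0.
have cts a' b' : exists2 d : R, 0 < d & forall y, U y -> `|y - x| < d ->
    `|pd a' (pd b' f) y - pd a' (pd b' f) x| < eps / 2.
  have := Cinfty_continuous (Cinfty_pd a' (Cinfty_pd b' hf)).
  by move=> /continuous_onP/(_ x Ux _ e2).
have [d1 d10 h1] := cts a b; have [d2 d20 h2] := cts b a.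
have [d3 d30 h3] := Uo.2 x Ux.
(* Including [x 0 ord0] in the minimum keeps points of the smaller box, displaced by at most
   [r / 4], off the boundary. *)
pose r := Num.min (Num.min d1 d2) (Num.min d3 (x 0 ord0)).
have r0 : 0 < r by rewrite !lt_min d10 d20 d30.
have boxU y : open_box x r y -> [/\ U y, `|y - x| < d1, `|y - x| < d2 & 0 < y 0 ord0].
  move=> [+ y0]; rewrite !lt_min => /andP[/andP[? ?] /andP[? ?]]; split=> //.
  by apply: h3; split=> //; apply: ltW.
have r2 : 0 < r / 4 by rewrite divr_gt0.
have shift_in u s c : open_box x (r / 4) u -> `|s| <= r / 4 ->
    open_box x r (u + s *: evec c).
  have r4 : r <= x 0 ord0 by rewrite /r !ge_min lexx !orbT.
  move=> [u1 u2] hs; split.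
    rewrite addrAC; apply: le_lt_trans (ler_normD _ _) _.
    have := norm_scale_evec s c; lra.
  have := le_lt_trans (coord_le_norm (u - x) ord0) u1.
  rewrite sub_coord shift_coord ltr_norml => /andP[? ?].
  move: hs; rewrite ler_norml => /andP[? ?].
  by case: (_ == _); rewrite ?mulr1n ?mulr0n; lra.
pose s := r / 8; have s0 : 0 < s by rewrite /s divr_gt0.
have hs : `|s| <= r / 4 by rewrite gtr0_norm // /s; lra.
have key a' b' d : (forall y, U y -> `|y - x| < d ->
      `|pd a' (pd b' f) y - pd a' (pd b' f) x| < eps / 2) ->
    (forall y, open_box x r y -> `|y - x| < d) ->
    `|f (x + s *: evec b' + s *: evec a') - f (x + s *: evec b')
      - (f (x + s *: evec a') - f x) - pd a' (pd b' f) x * s * s| <= eps / 2 * s * s.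
  move=> hd rd.
  have := @increment_step R n x (r / 4)
    (fun y => f (y + s *: evec a') - f y)
    (fun y => pd b' f (y + s *: evec a') - pd b' f y) b'
    (pd a' (pd b' f) x * s) (eps / 2 * s) x s.
  rewrite [`|s|]gtr0_norm //; apply.
  - move=> y hy; have hy' := shift_in y s a' hy hs.
    have [Uy' _ _ y'0] := boxU _ hy'.
    have [Uy _ _ y0] : [/\ U y, `|y - x| < d1, `|y - x| < d2 & 0 < y 0 ord0].
      apply: boxU; case: hy => u1 u2; split=> //; lra.
    apply: is_deriveB; last exact: Cinfty_is_derive hf Uy y0.
    have := Cinfty_is_derive b' hf Uy' y'0 => /cvg_is_derive H.
    apply: is_derive_cvg; move: H; rewrite (_ : (fun _ => _) =
      (fun h : R => h^-1 *: (((fun z => f (z + s *: evec a')) \o shift y) (h *: evec b')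
        - f (y + s *: evec a')))) //.
    by apply/funext => h /=; rewrite addrA.
  - move=> y hy.
    have hy' := shift_in y s a' hy hs.
    have hy2 : open_box x r y by case: hy => u1 u2; split=> //; lra.
    have := @increment_step R n x r (pd b' f) (pd a' (pd b' f)) a'
      (pd a' (pd b' f) x) (eps / 2) y s.
    rewrite [`|s|]gtr0_norm //; apply => // z hz; have [Uz _ _ z0] := boxU _ hz.
      exact: Cinfty_is_derive (Cinfty_pd b' hf) Uz z0.
    by apply: ltW; apply: hd => //; apply: rd.
  - by split=> //; rewrite subrr normr0.
  - split; last by have [] := shift_in x s b' (conj (_ : `|x - x| < r / 4) x0) hs;
      rewrite ?subrr ?normr0.
    rewrite addrC addKr; apply: le_lt_trans (norm_scale_evec _ _) _.
    by rewrite gtr0_norm // /s; lra.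
have k1 := key a b d1 h1 (fun y hy => let: And4 _ p _ _ := boxU y hy in p).
have k2 := key b a d2 h2 (fun y hy => let: And4 _ _ p _ := boxU y hy in p).
rewrite [x + s *: evec a + _]addrAC in k2.
exact: second_difference_bound s0 k1 k2.
Qed.

End ChainRule.

(** * Extending solutions of linear systems to the boundary *)

Section LinearSystems.
Context {R : realType} {n : nat}.
Implicit Types (x y z w v : 'rV[R]_n.+1) (a b c : 'I_n.+1) (e K : R).
Implicit Types (f F : 'rV[R]_n.+1 -> R) (S U V : set 'rV[R]_n.+1).

Lemma rel_open_half_box x e : rel_open (half_box x e).
Proof.
split=> [y []//|y [ye y0]]; exists (e - `|y - x|); first by rewrite subr_gt0.
move=> z [ze z0]; split=> //; rewrite -(subrKA y).
by apply: le_lt_trans (ler_normD _ _) _; lra.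
Qed.

Lemma coord_sum_le_norm y : \sum_a `|y 0 a| <= n.+1%:R * `|y|.
Proof.
apply: le_trans (ler_sum _ (fun a _ => coord_le_norm y a)) _.
by rewrite sumr_const card_ord mulr_natl.
Qed.

Lemma open_box_lipschitz x e f (f' : 'I_n.+1 -> 'rV[R]_n.+1 -> R) K y z :
  (forall a w, open_box x e w -> is_derive w (evec a) f (f' a w)) ->
  (forall a w, open_box x e w -> `|f' a w| <= K) -> 0 <= K ->
  open_box x e y -> open_box x e z ->
  `|f z - f y| <= K * n.+1%:R * `|z - y|.
Proof.
move=> hd hb K0 hy hz.
have hb' a w : open_box x e w -> `|f' a w - 0| <= K by rewrite subr0; apply: hb.
have := increment_open (c := fun=> 0) hd hb' hy hz.
under eq_bigr do rewrite mul0r.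
rewrite big1 // subr0 => /le_trans; apply; rewrite -mulrA ler_wpM2l //.
apply: le_trans (coord_sum_le_norm (z - y)).
by apply: ler_sum => a _; rewrite sub_coord.
Qed.

(* McShane's extension [F x = sup_(y in S) (f y - K |x - y|)]. *)
Lemma lipschitz_extension S f K q : S q -> 0 <= K ->
  (forall y z, S y -> S z -> `|f z - f y| <= K * `|z - y|) ->
  exists F, (forall y, S y -> F y = f y) /\
    forall y z, `|F z - F y| <= K * `|z - y|.
Proof.
move=> Sq K0 hf.
pose A x : set R := [set f y - K * `|x - y| | y in S].
have Aub x : ubound (A x) (f q + K * `|x - q|).
  move=> _ [y Sy <-]; have := hf q y Sq Sy; rewrite ler_norml => /andP[_ h].
  have : K * `|y - q| <= K * `|x - q| + K * `|x - y|.
    rewrite -mulrDr ler_wpM2l // -[y - q](subrKA x) addrC [`|x - y|]distrC.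
    exact: ler_normD.
  lra.
have Asup x : has_sup (A x).
  by split; [exists (f q - K * `|x - q|), q|exists (f q + K * `|x - q|)].
exists (fun x => sup (A x)); split.
  move=> y Sy; apply/eqP; rewrite eq_le; apply/andP; split.
    apply: ge_sup; first by have [] := Asup y.
    move=> _ [z Sz <-]; have := hf y z Sy Sz; rewrite ler_norml => /andP[_ h].
    by rewrite distrC; lra.
  by apply: sup_upper_bound => //; exists y => //; rewrite subrr normr0 mulr0 subr0.
have half y z : sup (A z) <= sup (A y) + K * `|z - y|.
  apply: ge_sup; first by have [] := Asup z.
  move=> _ [w Sw <-].
  have : f w - K * `|y - w| <= sup (A y) by apply: sup_upper_bound => //; exists w.
  have : K * `|y - w| <= K * `|z - y| + K * `|z - w|.
    rewrite -mulrDr ler_wpM2l // -[y - w](subrKA z) [`|z - y|]distrC.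
    exact: ler_normD.
  lra.
move=> y z; have := half y z; have := half z y.
by rewrite [`|y - z|]distrC ler_norml => ? ?; apply/andP; split; lra.
Qed.

Section System.
Variables (x0 : 'rV[R]_n.+1) (e : R) (k : nat).
Variables (X : 'rV[R]_n.+1 -> 'M[R]_k) (D : 'I_n.+1 -> 'rV[R]_n.+1 -> 'M[R]_k).
Variable (C : R).
Hypothesis (e0 : 0 < e) (hx0 : half_space x0) (C0 : 0 <= C).

Let rhs a w := D a w *m X w + X w *m (D a w)^T.

Hypothesis X_derive : forall a w i j, open_box x0 e w ->
  is_derive w (evec a) (fun y => X y i j) (rhs a w i j).
Hypothesis D_bounded : forall a w i j, open_box x0 e w -> `|D a w i j| <= C.

Let sqnorm y : R := \sum_i \sum_j X y i j * X y i j.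

Lemma entry_le_sqnorm y i j : X y i j * X y i j <= sqnorm y.
Proof.
rewrite /sqnorm (bigD1 i) //= (bigD1 j) //= -addrA lerDl addr_ge0 //.
  by apply: sumr_ge0 => l _; rewrite -expr2 sqr_ge0.
by apply: sumr_ge0 => l _; apply: sumr_ge0 => m _; rewrite -expr2 sqr_ge0.
Qed.

Lemma entries_le_sqnorm y i j l m : `|X y i j * X y l m| <= sqnorm y.
Proof.
have := entry_le_sqnorm y i j; have := entry_le_sqnorm y l m.
move: (X y i j) (X y l m) (sqnorm y) => s t E h1 h2.
by rewrite ler_norml; apply/andP; split; nra.
Qed.

Lemma rhs_entry_bound a w i j (M : R) : open_box x0 e w ->
  (forall l m, `|X w l m| <= M) -> `|rhs a w i j| <= 2 * k%:R * C * M.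
Proof.
move=> hw hM; rewrite /rhs !mxE; apply: le_trans (ler_normD _ _) _.
have -> : 2 * k%:R * C * M = k%:R * (C * M) + k%:R * (C * M) by ring.
apply: lerD; apply: le_trans (ler_norm_sum _ _ _) _.
  rewrite mulr_natl -[X in _ *+ X]card_ord -sumr_const; apply: ler_sum => l _.
  by rewrite normrM; apply: ler_pM => //; apply: D_bounded.
rewrite mulr_natl -[X in _ *+ X]card_ord -sumr_const; apply: ler_sum => l _.
by rewrite normrM mulrC !mxE; apply: ler_pM => //; apply: D_bounded.
Qed.

Lemma sqnorm_derive_bound a w i j : open_box x0 e w ->
  `|X w i j * rhs a w i j| <= 2 * k%:R * C * sqnorm w.
Proof.
move=> hw; rewrite /rhs !mxE mulrDr; apply: le_trans (ler_normD _ _) _.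
have -> : 2 * k%:R * C * sqnorm w =
  k%:R * (C * sqnorm w) + k%:R * (C * sqnorm w) by ring.
apply: lerD; rewrite mulr_sumr; apply: le_trans (ler_norm_sum _ _ _) _.
  rewrite mulr_natl -[X in _ *+ X]card_ord -sumr_const; apply: ler_sum => l _.
  rewrite mulrCA normrM; apply: ler_pM => //; first exact: D_bounded.
  exact: entries_le_sqnorm.
rewrite mulr_natl -[X in _ *+ X]card_ord -sumr_const; apply: ler_sum => l _.
rewrite mulrA normrM mulrC !mxE; apply: ler_pM => //; first exact: D_bounded.
exact: entries_le_sqnorm.
Qed.

Lemma center_pushed : exists q, open_box x0 e q.
Proof.
have hx : half_box x0 e x0 by split=> //; rewrite subrr normr0.
by have [t _ ht] := push_half_box hx e0; exists (x0 + t *: evec ord0).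
Qed.

(* Gronwall's inequality, in the form: [ln (1 + |X|^2)] is Lipschitz. *)
Lemma system_bounded : exists2 M : R, 0 <= M &
  forall w, open_box x0 e w -> forall i j, `|X w i j| <= M.
Proof.
have [q hq] := center_pushed.
have sq0 y : 0 <= sqnorm y.
  by apply: sumr_ge0 => i _; apply: sumr_ge0 => j _; rewrite -expr2 sqr_ge0.
have sq1 y : 0 < 1 + sqnorm y by have := sq0 y; lra.
pose s a w : R := \sum_i \sum_j (X w i j * rhs a w i j + X w i j * rhs a w i j).
have dsq a w : open_box x0 e w -> is_derive w (evec a) sqnorm (s a w).
  move=> hw; apply: is_derive_bigsum => i _; apply: is_derive_bigsum => j _.
  by apply: is_deriveM; apply: X_derive.
have dln a w : open_box x0 e w -> is_derive w (evec a)
    (fun y => ln (1 + sqnorm y)) ((1 + sqnorm w)^-1 * (0 + s a w)).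
  move=> hw; apply: (is_derive_comp1 (f := fun y => 1 + sqnorm y) (g := @ln R)).
    by apply: is_deriveD; apply: dsq.
  exact: is_derive1_ln.
(* There are [k * k] entries, and each contributes twice the bound [2 * k%:R * C * sqnorm w] of
   [sqnorm_derive_bound]. *)
pose K : R := k%:R * (k%:R * (4 * k%:R * C)).
have K0 : 0 <= K by rewrite !mulr_ge0.
have bln a w : open_box x0 e w -> `|(1 + sqnorm w)^-1 * (0 + s a w)| <= K.
  move=> hw; rewrite add0r normrM gtr0_norm ?invr_gt0 // ler_pdivrMl //.
  suff h : `|s a w| <= K * sqnorm w.
    by apply: le_trans h _; rewrite mulrC ler_wpM2r // lerDr.
  rewrite /K -!mulrA; apply: le_trans (ler_norm_sum _ _ _) _.
  rewrite mulr_natl -[X in _ *+ X]card_ord -sumr_const; apply: ler_sum => i _.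
  apply: le_trans (ler_norm_sum _ _ _) _.
  rewrite mulr_natl -[X in _ *+ X]card_ord -sumr_const; apply: ler_sum => j _.
  apply: le_trans (ler_normD _ _) _.
  by have := sqnorm_derive_bound a i j hw; lra.
(* Any two points of the box are at distance at most [2 * e], so the Lipschitz bound on the
   logarithm is uniform. *)
exists (expR (ln (1 + sqnorm q) + K * n.+1%:R * (2 * e))); first exact: expR_ge0.
move=> w hw i j; have := open_box_lipschitz dln bln K0 hq hw.
have wq : `|w - q| <= 2 * e.
  rewrite -(subrKA x0); apply: le_trans (ler_normD _ _) _.
  by case: hw hq => h1 _ [h2 _]; rewrite [`|x0 - q|]distrC; lra.
rewrite ler_norml => /andP[_ h].
have Kn : K * n.+1%:R * `|w - q| <= K * n.+1%:R * (2 * e).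
  by apply: ler_wpM2l => //; rewrite mulr_ge0.
have : 1 + sqnorm w <= expR (ln (1 + sqnorm q) + K * n.+1%:R * (2 * e)).
  rewrite -{1}[1 + sqnorm w]lnK ?posrE // ler_expR; lra.
(* An entry is bounded through [|t| <= 1 + t ^ 2]. *)
apply: le_trans; have := entry_le_sqnorm w i j.
by rewrite ler_norml => ?; apply/andP; split; nra.
Qed.

(** Boundedness of [X] bounds the right-hand side of the system, so every entry is Lipschitz and
    [lipschitz_extension] applies. *)
Lemma system_extension_continuous : exists Xb : 'rV[R]_n.+1 -> 'M[R]_k,
  (forall w, open_box x0 e w -> Xb w = X w) /\
  forall i j V, {within V, continuous (fun y => Xb y i j)}.
Proof.
have [q hq] := center_pushed; have [M M0 hM] := system_bounded.
have L i j : exists F, (forall w, open_box x0 e w -> F w = X w i j) /\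
    forall V, {within V, continuous F}.
  have dX a w : open_box x0 e w ->
    is_derive w (evec a) (fun y => X y i j) (rhs a w i j) by apply: X_derive.
  have bX a w : open_box x0 e w -> `|rhs a w i j| <= 2 * k%:R * C * M.
    by move=> hw; apply: rhs_entry_bound => // l m; apply: hM.
  have K0 : 0 <= 2 * k%:R * C * M by rewrite !mulr_ge0.
  have K1 : 0 <= 2 * k%:R * C * M * n.+1%:R by rewrite mulr_ge0.
  have [F [F1 F2]] := lipschitz_extension hq K1
    (fun y z hy hz => open_box_lipschitz dX bX K0 hy hz).
  exists F; split=> // V; apply/continuous_onP => y _ r r0.
  set L := 2 * _ * _ * _ * _ in K1 F2.
  have L1 : 0 < L + 1 by lra.
  exists (r / (L + 1)); first by rewrite divr_gt0.
  move=> z _; rewrite ltr_pdivlMr // mulrDr mulr1 mulrC => h.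
  by apply: le_lt_trans (F2 y z) _; apply: le_lt_trans h; rewrite lerDl.
have /choice[F1 h1] i : exists Fi : 'I_k -> 'rV[R]_n.+1 -> R, forall j,
    (forall w, open_box x0 e w -> Fi j w = X w i j) /\
    forall V, {within V, continuous (Fi j)}.
  by have /choice[Fi hFi] := L i; exists Fi.
exists (fun y => \matrix_(i, j) F1 i j y); split.
  by move=> w hw; apply/matrixP => i j; rewrite mxE; apply: (h1 i j).1.
move=> i j V; have := (h1 i j).2 V; apply: eq_continuous_on => y _.
by rewrite mxE.
Qed.

(** The entries of [Xb] and the smooth functions generate an algebra closed under interior
    differentiation, since the system writes the derivatives of [X] as polynomials in [D] and
    [X]. *)
Lemma system_extension :
  (forall a i j, Cinfty_on (half_box x0 e) (fun y => D a y i j)) ->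
  exists Xb : 'rV[R]_n.+1 -> 'M[R]_k,
  (forall w, open_box x0 e w -> Xb w = X w) /\
  forall i j, Cinfty_on (half_box x0 e) (fun y => Xb y i j).
Proof.
move=> hD; have [Xb [h1 h2]] := system_extension_continuous.
have Vo := rel_open_half_box x0 e.
exists Xb; split=> // i j.
apply: (@alg_Cinfty _ _ (fun f => Cinfty_on (half_box x0 e) f \/
    exists i j, f = fun y => Xb y i j)) => //; last first.
- by apply: alg_base; right; exists i, j.
- move=> {i j} f a [hf|[i [j ->]]].
    exists (pd a f); first by apply: alg_base; left; apply: Cinfty_pd.
    by move=> x Ux xp; apply: Cinfty_is_derive Ux xp.
  exists (fun y => \sum_l D a y i l * Xb y l j + \sum_l Xb y i l * D a y j l).
    apply: alg_add; apply: alg_sum => l _; apply: alg_mul; apply: alg_base.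
    - by left.
    - by right; exists l, j.
    - by right; exists i, l.
    - by left.
  move=> w [w1 w2] wp; have hw : open_box x0 e w by split.
  have -> : \sum_l D a w i l * Xb w l j + \sum_l Xb w i l * D a w j l = rhs a w i j.
    rewrite /rhs !mxE h1 //; congr (_ + _).
    by apply: eq_bigr => l _; rewrite [in RHS]mxE.
  apply: near_eq_is_derive (X_derive a i j hw).
  have : \forall y \near w, half_box x0 e y /\ 0 < y 0 ord0.
    by apply: interior_near => //; split.
  by apply: filterS => y [[y1 y2] yp]; rewrite h1.
- move=> f [/Cinfty_continuous //|[i' [j' ->]]]; exact: h2.
Qed.

End System.
End LinearSystems.

(** * Hadamard's lemma *)

Section Hadamard.
Context {R : realType} {n : nat}.
Implicit Types (x y z w v : 'rV[R]_n.+1) (a b c : 'I_n.+1) (e K : R) (m : nat).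
Implicit Types (f g : 'rV[R]_n.+1 -> R).

Lemma rel_open_open_box x e : rel_open (open_box x e).
Proof.
split=> [y [_ /ltW]//|y [ye y0]].
exists (Num.min (e - `|y - x|) (y 0 ord0)); first by rewrite lt_min subr_gt0 ye.
move=> z [+ _]; rewrite lt_min => /andP[z1 z2]; split.
  rewrite -(subrKA y); apply: le_lt_trans (ler_normD _ _) _; lra.
have := le_lt_trans (coord_le_norm (z - y) ord0) z2.
by rewrite sub_coord ltr_norml => /andP[? ?]; lra.
Qed.

Lemma is_derive_coordX a m x : is_derive x (evec a) (fun y => y 0 ord0 ^+ m.+1)
  (m.+1%:R * x 0 ord0 ^+ m * (ord0 == a)%:R : R).
Proof.
elim: m => [|m IH].
  rewrite expr0 mul1r mul1r (_ : (fun _ => _) = (fun y => y 0 ord0)).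
    exact: is_derive_coord.
  by apply/funext => y; rewrite expr1.
have H := is_deriveM (is_derive_coord a ord0 x) IH.
rewrite (_ : (fun _ => _) = (fun y => y 0 ord0) * (fun y => y 0 ord0 ^+ m.+1)).
  apply: is_derive_eq H _; rewrite /GRing.scale /= exprS -[m.+2%:R]natr1; ring.
by apply/funext => y; rewrite exprS.
Qed.

Variables (x0 : 'rV[R]_n.+1) (e : R).
Hypothesis x00 : x0 0 ord0 = 0.
Let U := half_box x0 e.
Let Uo : rel_open U := rel_open_half_box x0 e.

Definition vanishing f := forall y, U y -> y 0 ord0 = 0 -> f y = 0.

Definition normal_pd m f := iter m (pd ord0) f.

(* [normal_num m f / y_0 ^ m.+1] is the [m]-th normal derivative of [f / y_0]. *)
Fixpoint normal_num m f : 'rV[R]_n.+1 -> R :=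
  if m is m'.+1 then
    fun y => y 0 ord0 ^+ m * normal_pd m f y - m%:R * normal_num m' f y
  else f.

Lemma Cinfty_normal_pd m f : Cinfty_on U f -> Cinfty_on U (normal_pd m f).
Proof. by move=> hf; elim: m => //= m IH; apply: Cinfty_pd. Qed.

Lemma Cinfty_normal_num m f : Cinfty_on U f -> Cinfty_on U (normal_num m f).
Proof.
move=> hf; elim: m => //= m IH; apply: CinftyB => //; apply: CinftyM => //.
- by apply: CinftyX => //; apply: Cinfty_coord.
- by apply: Cinfty_pd; apply: Cinfty_normal_pd.
- exact: Cinfty_cst.
Qed.

Lemma normal_num_vanishing m f : vanishing f -> vanishing (normal_num m f).
Proof.
move=> hf; elim: m => //= m IH y Uy y0.
by rewrite y0 expr0n mul0r IH // mulr0 subrr.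
Qed.

(** When the recursion is differentiated, the two terms in the derivative of order [m] cancel and
    only the leading one remains. *)
Lemma is_derive_normal_num m f y : Cinfty_on U f -> U y -> 0 < y 0 ord0 ->
  is_derive y (evec ord0) (normal_num m f) (y 0 ord0 ^+ m * normal_pd m.+1 f y).
Proof.
move=> hf Uy y0; elim: m => [|m IH].
  by rewrite expr0 mul1r; apply: Cinfty_is_derive hf Uy y0.
have h1 := is_deriveM (is_derive_coordX ord0 m y)
  (Cinfty_is_derive ord0 (Cinfty_normal_pd m.+1 hf) Uy y0).
rewrite eqxx mulr1 in h1.
have h2 := is_deriveM (is_derive_cst (m.+1%:R : R) y (evec ord0)) IH.
have h3 := is_deriveB h1 h2.
apply: is_derive_eq h3 _; rewrite /GRing.scale /= /cst /=; ring.
Qed.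

Lemma pd_normal_pd m f a y : Cinfty_on U f -> U y -> 0 < y 0 ord0 ->
  pd a (normal_pd m f) y = normal_pd m (pd a f) y.
Proof.
move=> hf; elim: m y => //= m IH y Uy y0.
rewrite (iterated_pd_comm _ _ Uo (Cinfty_normal_pd m hf)) //.
apply: (eq_pd _ (rel_open_open_box x0 e)).
  by case: Uy => ye _; split.
by move=> z [ze z0]; apply: IH => //; split=> //; apply: ltW.
Qed.

Lemma is_derive_normal_num_tangent m f a y : a != ord0 -> Cinfty_on U f ->
  U y -> 0 < y 0 ord0 ->
  is_derive y (evec a) (normal_num m f) (normal_num m (pd a f) y).
Proof.
move=> a0 hf Uy y0; elim: m => [|m IH]; first exact: Cinfty_is_derive hf Uy y0.
have h1 := is_deriveM (is_derive_coordX a m y)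
  (Cinfty_is_derive a (Cinfty_normal_pd m.+1 hf) Uy y0).
rewrite eq_sym (negPf a0) mulr0 in h1.
have h2 := is_deriveM (is_derive_cst (m.+1%:R : R) y (evec a)) IH.
have h3 := is_deriveB h1 h2.
apply: is_derive_eq h3 _; rewrite pd_normal_pd // /GRing.scale /= /cst /=.
ring.
Qed.

Lemma vanishing_pd f a : a != ord0 -> vanishing f -> vanishing (pd a f).
Proof.
move=> a0 hf y Uy y0; apply: (pd_limit _ _).2; first by apply: Uo.1.
apply: (@cvg_trans _ ((fun=> 0 : R) @ pd_filter a y)); last first.
  by have := pd_filter_filter a y => ?; apply: cvg_cst.
have FF := pd_filter_filter a y; apply: near_eq_cvg.
have [d d0 hd] := Uo.2 y Uy; apply/pd_filterP; exists d => // t td t0 ht.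
rewrite /pd_quotient !hf ?subrr ?mulr0 //.
  apply: hd; split=> //; rewrite [y + _]addrC addrK.
  exact: le_lt_trans (norm_scale_evec _ _) td.
by rewrite (shift_coord y t a ord0) eq_sym (negPf a0) y0 mulr0n addr0.
Qed.

(** Cauchy's mean value theorem for [normal_num m f] and [t ^+ m.+1] on the normal segment from the
    boundary to [y]; both vanish at its foot. The bound on [z] makes it converge to the boundary
    point [x] together with [y]. *)
Lemma normal_num_mean_value m f y x : Cinfty_on U f -> vanishing f ->
  U y -> 0 < y 0 ord0 -> x 0 ord0 = 0 ->
  exists z, [/\ U z, `|z - x| <= `|y - x| &
    m.+1%:R * normal_num m f y = y 0 ord0 ^+ m.+1 * normal_pd m.+1 f z].
Proof.
move=> hf vf Uy y0 x_0; set s := y 0 ord0 in y0 *.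
pose yb := y - s *: evec ord0; pose P := normal_num m f.
have coordE t b : (yb + t *: evec ord0) 0 b = y 0 b + (t - s) *+ (b == ord0).
  by rewrite /yb -scaleNr !shift_coord -addrA -mulrnDl [- s + t]addrC.
have inU t : 0 <= t <= s -> U (yb + t *: evec ord0).
  move=> /andP[t0 ts]; have [ye _] := Uy; have ep : 0 < e by apply: le_lt_trans ye.
  split; last by rewrite /half_space /= coordE eqxx mulr1n; rewrite -/s; lra.
  apply/row_norm_ltP => // b; move/(row_norm_ltP _ ep)/(_ b): ye.
  rewrite !sub_coord coordE; have [->|_] := eqVneq b ord0; last by rewrite mulr0n addr0.
  by rewrite x00 -/s mulr1n !ltr_norml => /andP[? ?]; apply/andP; split; lra.
have ybs : yb + s *: evec ord0 = y by rewrite /yb subrK.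
(* The auxiliary function of Cauchy's theorem: it vanishes at both ends, so Rolle's theorem gives a
   critical point. *)
pose chi (t : R) := P (yb + t *: evec ord0) * s ^+ m.+1 - P y * t ^+ m.+1.
have dchi t : 0 < t < s -> is_derive t 1 chi
    (t ^+ m * (normal_pd m.+1 f (yb + t *: evec ord0) * s ^+ m.+1 - m.+1%:R * P y)).
  move=> /andP[t0 ts].
  have tE : (yb + t *: evec ord0) 0 ord0 = t by rewrite coordE eqxx mulr1n -/s; lra.
  have := @is_derive_normal_num m f (yb + t *: evec ord0) hf.
  rewrite tE => /(_ _ t0)/is_derive_slice H1.
  have {}H1 := H1 (inU _ _).
  have H2 : is_derive t 1 (fun r : R => r ^+ m.+1) (m.+1%:R * t ^+ m).
    split; first exact: exprn_derivable.
    by rewrite exp_derive [_ *: 1]mulr1.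
  have c1 := is_derive_cst (s ^+ m.+1 : R) t (1 : R).
  have c2 := is_derive_cst (P y) t (1 : R).
  have H := is_deriveB (is_deriveM (H1 _) c1) (is_deriveM c2 H2).
  apply: is_derive_eq; first by apply: H; rewrite !ltW.
  by rewrite /GRing.scale /= /cst /=; ring.
have cchi : {within `[0, s], continuous chi}.
  have /continuous_onP Pc := Cinfty_continuous (Cinfty_normal_num m hf).
  apply/subspace_continuousP => t; rewrite /= in_itv /= => ht.
  apply: cvgB; apply: cvgM; try exact: cvg_cst.
    apply/cvgrPdist_lt => r r0; have [d d0 hd] := Pc _ (inU t ht) r r0.
    apply/nbhs_ballP; exists d => // t'; rewrite -ball_normE /= => tt'.
    rewrite in_itv /= => ht'; rewrite distrC; apply: hd; first exact: inU.
    rewrite opprD addrACA subrr add0r -scalerBl.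
    by apply: le_lt_trans (norm_scale_evec _ _) _; rewrite distrC.
  apply: cvg_within_filter; apply: (differentiable_continuous (f := fun r : R => r ^+ m.+1)).
  exact/derivable1_diffP/exprn_derivable.
have chi0 : chi 0 = chi s.
  rewrite /chi ybs subrr scale0r addr0 expr0n mulr0 subr0.
  rewrite (_ : P yb = 0) ?mul0r //.
  apply: normal_num_vanishing => //.
    by have := inU 0; rewrite scale0r addr0; apply; rewrite lexx ltW.
  by have := coordE 0 ord0; rewrite scale0r addr0 => ->; rewrite eqxx mulr1n -/s; lra.
have chid t : t \in `]0, s[ -> derivable chi t 1.
  by rewrite in_itv /= => /dchi[].
have [t ht [_ dt0]] := Rolle y0 chid cchi chi0.
move: ht; rewrite in_itv /= => ht; have [_ dt1] := dchi t ht.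
have := ht; move=> /andP[t0 ts].
exists (yb + t *: evec ord0); split.
- by apply: inU; rewrite !ltW.
- case: (eqVneq `|y - x| 0) => [/normr0_eq0/subr0_eq yx|nz].
    by move: y0; rewrite /s yx x_0 ltxx.
  have np : 0 < `|y - x| by rewrite lt_neqAle eq_sym nz normr_ge0.
  apply/ler_addgt0Pr => r r0; apply: ltW; apply/row_norm_ltP; first by rewrite addr_gt0.
  move=> b; have := coord_le_norm (y - x) b; rewrite !sub_coord coordE.
  have [->|_] := eqVneq b ord0; last by rewrite mulr0n addr0 => h; lra.
  by rewrite x_0 -/s mulr1n !subr0 !gtr0_norm; lra.
- have tm : t ^+ m != 0 by rewrite expf_neq0 // gt_eqF.
  move: dt0; rewrite dt1 => /eqP; rewrite mulf_eq0 (negPf tm) /= subr_eq0 => /eqP h.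
  by rewrite -/P -h mulrC.
Qed.

(** The [m]-th normal derivative of [f / y_0]; its boundary value is the limit dictated by
    [normal_num_mean_value]. *)
Definition normal_quotient m f y : R :=
  if 0 < y 0 ord0 then normal_num m f y / y 0 ord0 ^+ m.+1
  else normal_pd m.+1 f y / m.+1%:R.

Lemma normal_quotient_continuous m f : Cinfty_on U f -> vanishing f ->
  {within U, continuous (normal_quotient m f)}.
Proof.
move=> hf vf; apply/continuous_onP => x Ux r r0.
have [xp|xn] := ltP 0 (x 0 ord0); last first.
  have x_0 : x 0 ord0 = 0 by apply/eqP; rewrite eq_le xn; apply: Uo.1.
  have /continuous_onP/(_ x Ux r r0)[d d0 hd] :=
    Cinfty_continuous (Cinfty_normal_pd m.+1 hf).
  exists d => // y Uy yd; rewrite /normal_quotient x_0 ltxx.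
  have bound z : U z -> `|z - x| < d ->
      `|normal_pd m.+1 f z / m.+1%:R - normal_pd m.+1 f x / m.+1%:R| < r.
    move=> Uz zd; rewrite -mulrBl normrM normfV normr_nat ltr_pdivrMr ?ltr0n //.
    apply: lt_le_trans (hd z Uz zd) _.
    by rewrite ler_peMr ?ler1n //; apply: ltW.
  case: ifPn => [yp|_]; last exact: bound.
  have [z [Uz zx hz]] := normal_num_mean_value m hf vf Uy yp x_0.
  rewrite (_ : normal_num m f y / _ = normal_pd m.+1 f z / m.+1%:R).
    by apply: bound => //; apply: le_lt_trans zx yd.
  have yn : y 0 ord0 ^+ m.+1 != 0 by rewrite expf_neq0 // gt_eqF.
  apply/eqP; rewrite eqr_div ?pnatr_eq0 //.
  by rewrite mulrC hz mulrC.
pose F y : R := normal_num m f y * (y 0 ord0 ^+ m.+1)^-1.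
have hF : Cinfty_on (open_box x0 e) F.
  have Oo := rel_open_open_box x0 e; apply: CinftyM => //.
    by apply: Cinfty_onS (Cinfty_normal_num m hf); apply: open_half_box.
  apply: CinftyV => //; first by move=> y [_ yp]; rewrite expf_neq0 // gt_eqF.
  by apply: CinftyX => //; apply: Cinfty_coord.
have Ox : open_box x0 e x by case: Ux.
have /continuous_onP/(_ x Ox r r0)[d d0 hd] := Cinfty_continuous hF.
have [t t0 ht] := (rel_open_open_box x0 e).2 x Ox.
exists (Num.min d t); first by rewrite lt_min d0.
move=> y Uy; rewrite lt_min => /andP[yd yt].
have Oy : open_box x0 e y by apply: ht; split=> //; apply: Uo.1.
by rewrite /normal_quotient xp Oy.2; apply: hd.
Qed.

Lemma normal_quotient_derive m f a y : Cinfty_on U f -> U y -> 0 < y 0 ord0 ->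
  is_derive y (evec a) (normal_quotient m f)
    (if a == ord0 then normal_quotient m.+1 f y else normal_quotient m (pd a f) y).
Proof.
move=> hf Uy y0; have yn : y 0 ord0 != 0 by rewrite gt_eqF.
have nb := interior_near Uo Uy y0.
apply: (@near_eq_is_derive _ _ _ (fun z => normal_num m f z * (z 0 ord0 ^+ m.+1)^-1)).
  by apply: filterS nb => z [_ z0]; rewrite /normal_quotient z0.
have hi := is_derive_inv (expf_neq0 m.+1 yn) (is_derive_coordX a m y).
rewrite /normal_quotient y0; case: (eqVneq a ord0) => [a0|a0].
  rewrite a0 eqxx mulr1 in hi *.
  have H := is_deriveM (is_derive_normal_num m hf Uy y0) hi.
  apply: is_derive_eq H _; rewrite /GRing.scale /= !exprS.
  by field; rewrite expf_neq0 yn.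
rewrite eq_sym (negPf a0) mulr0 mulr0 in hi.
have H := is_deriveM (is_derive_normal_num_tangent m a0 hf Uy y0) hi.
apply: is_derive_eq H _; rewrite /GRing.scale /=.
by rewrite !mulr0 add0r mulrC.
Qed.

(** The family of all normal quotients is stable under interior differentiation: a normal derivative
    raises [m], a tangential one replaces [f] by [pd a f], which still vanishes on the boundary. *)
Lemma Cinfty_normal_quotient m f : Cinfty_on U f -> vanishing f ->
  Cinfty_on U (normal_quotient m f).
Proof.
move=> hf vf; apply: (@alg_Cinfty _ _ (fun g => exists m f,
    [/\ Cinfty_on U f, vanishing f & g = normal_quotient m f])) => //; last first.
- by apply: alg_base; exists m, f.
- move=> _ a {m f hf vf} [m [f [hf vf ->]]].
  exists (if a == ord0 then normal_quotient m.+1 f else normal_quotient m (pd a f)).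
    apply: alg_base; case: eqVneq => [_|a0]; first by exists m.+1, f.
    by exists m, (pd a f); split=> //; [apply: Cinfty_pd|apply: vanishing_pd].
  move=> y Uy y0; have := normal_quotient_derive m a hf Uy y0.
  by case: (a == ord0).
- by move=> _ {m f hf vf} [m [f [hf vf ->]]]; apply: normal_quotient_continuous.
Qed.

Lemma hadamard f : Cinfty_on U f -> vanishing f ->
  exists q, [/\ Cinfty_on U q, forall y, U y -> f y = y 0 ord0 * q y &
    forall y, U y -> y 0 ord0 = 0 -> q y = pd ord0 f y].
Proof.
move=> hf vf; exists (normal_quotient 0 f); split.
- exact: Cinfty_normal_quotient.
- move=> y Uy; rewrite /normal_quotient; case: ltP => [y0|yn].
    by rewrite expr1 /= mulrC divfK // gt_eqF.
  have y0 : y 0 ord0 = 0 by apply/eqP; rewrite eq_le yn; apply: Uo.1.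
  by rewrite vf // y0 mul0r.
- by move=> y Uy y0; rewrite /normal_quotient y0 ltxx /= divr1.
Qed.

End Hadamard.

(** * Geometry in a boundary chart *)

Section ProjectiveChangeAlgebra.
Context {R : comRingType} {n : nat}.
Implicit Types (a b c k l : 'I_n.+1).

Lemma sum_delta (F : 'I_n.+1 -> R) a : \sum_k F k * (k == a)%:R = F a.
Proof.
rewrite (bigD1 a) //= eqxx mulr1 big1 ?addr0 // => k /negPf ->.
by rewrite mulr0.
Qed.

Lemma sum_delta_sym (F : 'I_n.+1 -> R) a : \sum_k F k * (a == k)%:R = F a.
Proof. by rewrite -[RHS]sum_delta; apply: eq_bigr => k _; rewrite eq_sym. Qed.

Variables (G : 'I_n.+1 -> 'I_n.+1 -> 'I_n.+1 -> R) (U : 'I_n.+1 -> R).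

Let Gh k a b := G k a b + U a * (k == b)%:R + U b * (k == a)%:R.

Lemma sum_projective_change c a (F : 'I_n.+1 -> R) :
  \sum_k Gh k c a * F k = \sum_k G k c a * F k + U c * F a + U a * F c.
Proof.
rewrite -(sum_delta (fun k => U c * F k) a) -(sum_delta (fun k => U a * F k) c).
by rewrite -!big_split; apply: eq_bigr => k _ /=; rewrite /Gh; ring.
Qed.

Variables (dG : 'I_n.+1 -> 'I_n.+1 -> 'I_n.+1 -> 'I_n.+1 -> R).
Variables (dU : 'I_n.+1 -> 'I_n.+1 -> R).

Let dGh a k b c := dG a k b c + dU a b * (k == c)%:R + dU a c * (k == b)%:R.

Definition ricci_expr (G : 'I_n.+1 -> 'I_n.+1 -> 'I_n.+1 -> R)
    (dG : 'I_n.+1 -> 'I_n.+1 -> 'I_n.+1 -> 'I_n.+1 -> R) b c : R :=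
  \sum_k (dG k k b c - dG b k k c +
    \sum_l (G k k l * G l b c - G k b l * G l k c)).

(** A polynomial identity in which [G], [U] and their derivatives are independent symbols, apart
    from the symmetry of [G]. Closedness of [U] is not assumed, so [Z] need not be symmetric. *)
Lemma ricci_expr_projective_change b c :
  (forall k a b, G k a b = G k b a) ->
  let Z a b := dU a b - \sum_k G k a b * U k in
  ricci_expr Gh dGh b c =
    ricci_expr G dG b c + Z c b - n.+1%:R * Z b c + n%:R * (U b * U c).
Proof.
move=> Gs Z; pose S := \sum_k G k b c * U k.
have ZE : Z c b - n.+1%:R * Z b c = dU c b - n.+1%:R * dU b c + n%:R * S.
  rewrite /Z; under eq_bigr do rewrite Gs; rewrite -/S -natr1; ring.
(* Each term that results from a Kronecker delta is written back as a sum over [l], so that the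
   identity can be checked summand by summand. *)
have inner1 k : \sum_l Gh k k l * Gh l b c = \sum_l G k k l * G l b c
    + G k k c * U b + G k k b * U c + U k * G k b c + U k * U b * (k == c)%:R
    + U k * U c * (k == b)%:R + S + U c * U b + U b * U c.
  rewrite -(sum_delta (fun l => G k k l * U b) c) -(sum_delta (fun l => G k k l * U c) b).
  rewrite -(sum_delta_sym (fun l => U k * G l b c) k).
  rewrite -(sum_delta_sym (fun l => U k * U b * (l == c)%:R) k).
  rewrite -(sum_delta_sym (fun l => U k * U c * (l == b)%:R) k).
  rewrite -(sum_delta (fun l => U l * U b) c) -(sum_delta (fun l => U l * U c) b).
  rewrite /S -!big_split; apply: eq_bigr => l _ /=; rewrite /Gh eqxx mulr1; ring.
have inner2 k : \sum_l Gh k b l * Gh l k c = \sum_l G k b l * G l k c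
    + G k b c * U k + G k b k * U c + U b * G k k c + U b * U k * (k == c)%:R
    + U b * U c + (\sum_l U l * G l k c) * (k == b)%:R
    + U c * U k * (k == b)%:R + U k * U c * (k == b)%:R.
  rewrite -(sum_delta (fun l => G k b l * U k) c) -(sum_delta (fun l => G k b l * U c) k).
  rewrite -(sum_delta_sym (fun l => U b * G l k c) k).
  rewrite -(sum_delta_sym (fun l => U b * U k * (l == c)%:R) k).
  have -> : U b * U c = \sum_l U b * U c * (l == k)%:R * (k == l)%:R.
    by rewrite (sum_delta_sym (fun l => U b * U c * (l == k)%:R)) eqxx mulr1.
  rewrite mulr_suml.
  rewrite -(sum_delta (fun l => U l * U k * (k == b)%:R) c).
  rewrite -(sum_delta (fun l => U l * U c * (k == b)%:R) k).
  rewrite -!big_split; apply: eq_bigr => l _ /=; rewrite /Gh; ring.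
rewrite -[_ + Z c b - _]addrA ZE /ricci_expr.
(* The summand is arranged so that [G k k b - G k b k] vanishes by symmetry, while summing the terms
   free of [k] produces the factors [n.+1]. *)
transitivity (\sum_k (dG k k b c - dG b k k c +
    \sum_l (G k k l * G l b c - G k b l * G l k c)
    + (dU k b * (k == c)%:R + dU k c * (k == b)%:R
       - dU b k * (k == c)%:R - dU b c)
    + (G k k b - G k b k) * U c + S - (\sum_l U l * G l k c) * (k == b)%:R
    + (U b * U c - U c * U k * (k == b)%:R))).
  apply: eq_bigr => k _; rewrite sumrB inner1 inner2 /dGh eqxx mulr1 sumrB; ring.
rewrite !big_split /= !sumrN !sum_delta.
have -> : \sum_i (G i i b - G i b i) * U c = 0.
  by apply: big1 => k _; rewrite Gs subrr mul0r.
have -> : \sum_l U l * G l b c = S by apply: eq_bigr => l _; rewrite mulrC.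
rewrite !sumr_const card_ord.
rewrite -[dU b c *+ _]mulr_natr -[S *+ _]mulr_natr -[(U b * U c) *+ _]mulr_natr.
by rewrite -natr1; ring.
Qed.

End ProjectiveChangeAlgebra.

(** * The tractor metric near a boundary point *)

Section ChartGeometry.
Context {R : realType} {n : nat}.
Implicit Types (x y z w : 'rV[R]_n.+1) (a b c k l : 'I_n.+1).
Variables (x0 : 'rV[R]_n.+1) (e : R).
Let V := half_box x0 e.
Let O := open_box x0 e.
Let Vo : rel_open V := rel_open_half_box x0 e.
Let Oo : rel_open O := rel_open_open_box x0 e.

Lemma eq_on_half_box (f h : 'rV[R]_n.+1 -> R) :
  {within V, continuous f} -> {within V, continuous h} ->
  (forall x, O x -> f x = h x) -> forall x, V x -> f x = h x.
Proof.
move=> /continuous_onP fc /continuous_onP hc fh x Vx.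
apply/eqP; rewrite -subr_eq0 -normr_le0; apply/ler_addgt0Pr => r r0; rewrite add0r.
have r2 : 0 < r / 2 by rewrite divr_gt0.
have [d1 d10 h1] := fc x Vx _ r2; have [d2 d20 h2] := hc x Vx _ r2.
have d0 : 0 < Num.min d1 d2 by rewrite lt_min d10.
have [t /andP[t0 td] ht] := push_half_box Vx d0.
have xt : `|x + t *: evec ord0 - x| < Num.min d1 d2.
  rewrite [x + _]addrC addrK; apply: le_lt_trans (norm_scale_evec _ _) _.
  by rewrite gtr0_norm.
move: (xt); rewrite lt_min => /andP[xt1 xt2].
have := h1 _ (open_half_box ht) xt1; have := h2 _ (open_half_box ht) xt2.
rewrite (fh _ ht); move: (h _) (f x) (h x) => p q s.
rewrite !ltr_norml ler_norml => /andP[? ?] /andP[? ?].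
by apply/andP; split; lra.
Qed.

Variables (g : 'rV[R]_n.+1 -> 'M[R]_n.+1).
Variables (Gam Gb : 'I_n.+1 -> 'I_n.+1 -> 'I_n.+1 -> 'rV[R]_n.+1 -> R).
Variables (rho0 : 'rV[R]_n.+1 -> R) (alpha S C : R).

Let U a y := (alpha * rho0 y)^-1 * pd a rho0 y.
Let dU a b y := pd a (U b) y.

Definition coord_ricci (Gam : 'I_n.+1 -> 'I_n.+1 -> 'I_n.+1 -> 'rV[R]_n.+1 -> R) b c x :=
  ricci_expr (fun k a b => Gam k a b x) (fun a k b c => pd a (Gam k b c) x) b c.

(* The projective Schouten tensor; the Ricci tensor of a projective change is *)
(* not known to be symmetric unless the one-form is known to be closed.       *)
Definition schouten (Gam : 'I_n.+1 -> 'I_n.+1 -> 'I_n.+1 -> 'rV[R]_n.+1 -> R) b c x :=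
  (n.+1%:R * coord_ricci Gam b c x + coord_ricci Gam c b x) / (n%:R * n.+2%:R).

Lemma Cinfty_schouten (A : set 'rV[R]_n.+1) G b c : rel_open A ->
  (forall k a b, Cinfty_on A (G k a b)) -> Cinfty_on A (schouten G b c).
Proof.
move=> Ao hG; have hr b' c' : Cinfty_on A (coord_ricci G b' c').
  apply: Cinfty_sum => // k _; apply: CinftyD => //.
    by apply: CinftyB => //; apply: Cinfty_pd.
  apply: Cinfty_sum => // l _.
  by apply: CinftyB => //; apply: CinftyM.
apply: CinftyM => //; last exact: Cinfty_cst.
by apply: CinftyD => //; apply: CinftyM => //; exact: Cinfty_cst.
Qed.

Hypotheses (x00 : x0 0 ord0 = 0) (e0 : 0 < e) (alpha0 : 0 < alpha) (S0 : S != 0).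
Hypothesis (n0 : (0 < n)%N).
Hypothesis g_smooth : forall a b, Cinfty_on O (fun x => g x a b).
Hypothesis g_sym : forall x a b, O x -> g x a b = g x b a.
Hypothesis g_unit : forall x, O x -> g x \in unitmx.
Hypothesis Gam_smooth : forall k a b, Cinfty_on O (Gam k a b).
Hypothesis Gam_sym : forall x k a b, O x -> Gam k a b x = Gam k b a x.
Hypothesis levi_civita_g : forall x a b c, O x ->
  pd c (fun y => g y a b) x = \sum_k (Gam k c a x * g x k b + Gam k c b x * g x a k).
Hypothesis einstein_g : forall x b c, O x ->
  coord_ricci Gam b c x = S / n.+1%:R * g x b c.
Hypothesis rho0_smooth : Cinfty_on V rho0.
Hypothesis rho0_pos : forall x, O x -> 0 < rho0 x.
Hypothesis rho0_vanishing : vanishing x0 e rho0.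
Hypothesis Gb_smooth : forall k a b, Cinfty_on V (Gb k a b).
Hypothesis Gb_eq : forall x k a b, O x ->
  Gb k a b x = Gam k a b x + U a x * (k == b)%:R + U b x * (k == a)%:R.
Hypothesis C1 : 1 <= C.
Hypothesis Gb_bounded : forall x k a b, V x -> `|Gb k a b x| <= C.
Hypothesis schouten_bounded : forall x a b, V x -> `|schouten Gb a b x| <= C.

Let lam := S / (n%:R * n.+1%:R).

Lemma lam_neq0 : lam != 0.
Proof. by rewrite mulf_neq0 // invr_neq0 // mulf_neq0 // pnatr_eq0 // -lt0n. Qed.

Lemma Cinfty_open f : Cinfty_on V f -> Cinfty_on O f.
Proof. by apply: Cinfty_onS; apply: open_half_box. Qed.

Lemma Upsilon_smooth a : Cinfty_on O (U a).
Proof.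
apply: CinftyM => //; last by apply: Cinfty_pd; apply: Cinfty_open.
apply: CinftyV => //; last first.
  by apply: CinftyM => //; [exact: Cinfty_cst|apply: Cinfty_open].
by move=> x Ox; rewrite gt_eqF // mulr_gt0 // rho0_pos.
Qed.

Lemma Upsilon_derive a b x : O x -> is_derive x (evec a) (U b) (dU a b x).
Proof. by move=> Ox; apply: Cinfty_is_derive (Upsilon_smooth b) Ox Ox.2. Qed.

Lemma pd_Gb a k b c x : O x -> pd a (Gb k b c) x =
  pd a (Gam k b c) x + dU a b x * (k == c)%:R + dU a c x * (k == b)%:R.
Proof.
move=> Ox; rewrite (eq_pd a Oo Ox (g := fun y =>
  Gam k b c y + U b y * (k == c)%:R + U c y * (k == b)%:R)); last first.
  by move=> y Oy; apply: Gb_eq.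
apply: pd_val Ox.2 _; apply: is_deriveD; first apply: is_deriveD.
- exact: Cinfty_is_derive Ox Ox.2.
- have H := is_deriveM (Upsilon_derive a b Ox)
    (is_derive_cst ((k == c)%:R : R) x (evec a)).
  by apply: is_derive_eq H _; rewrite scaler0 add0r [LHS]mulrC.
- have H := is_deriveM (Upsilon_derive a c Ox)
    (is_derive_cst ((k == b)%:R : R) x (evec a)).
  by apply: is_derive_eq H _; rewrite scaler0 add0r [LHS]mulrC.
Qed.

(** The Ricci tensor of [Gb] is [n lam g_bc + Z_cb - (n + 1) Z_bc + n U_b U_c]. In the combination
    defining [schouten] the transposed terms [Z_cb] cancel and [(n + 1) ^ 2 - 1 = n (n + 2)]
    multiplies the rest, so [schouten] equals [lam g + U U - Z]. *)
Lemma Upsilon_covariant_derivative b c x : O x ->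
  dU b c x = \sum_k Gam k b c x * U k x + lam * g x b c + U b x * U c x
    - schouten Gb b c x.
Proof.
move=> Ox; pose Z b c := dU b c x - \sum_k Gam k b c x * U k x.
have Rh b' c' : coord_ricci Gb b' c' x = S / n.+1%:R * g x b' c' + Z c' b'
    - n.+1%:R * Z b' c' + n%:R * (U b' x * U c' x).
  have P := ricci_expr_projective_change (fun a => U a x)
    (fun a k b c => pd a (Gam k b c) x) (fun a b => dU a b x) b' c'
    (fun k a b => Gam_sym k a b Ox).
  rewrite -einstein_g //; etransitivity; last exact: P.
  rewrite /coord_ricci; congr (ricci_expr _ _ b' c').
    by apply/funext => k; apply/funext => a; apply/funext => l; apply: Gb_eq.
  apply/funext => a; apply/funext => k; apply/funext => l; apply/funext => m.
  exact: pd_Gb.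
have -> : dU b c x = \sum_k Gam k b c x * U k x + Z b c by rewrite /Z addrC subrK.
rewrite /schouten !Rh (g_sym c b Ox) [U c x * _]mulrC /lam.
have nn : n%:R != 0 :> R by rewrite pnatr_eq0 -lt0n.
have n1 : n.+1%:R != 0 :> R by rewrite pnatr_eq0.
have n2 : n.+2%:R != 0 :> R by rewrite pnatr_eq0.
have e2 : n.+2%:R = n%:R + 2 :> R by rewrite -addn2 natrD.
have e1 : n.+1%:R = n%:R + 1 :> R by rewrite -addn1 natrD.
rewrite e1 e2 in n1 n2 *; field.
by rewrite nn n1 n2.
Qed.

(** The exponent is chosen so that [d tau = 2 tau U]. The formula is meaningful only where [rho0] is
    positive; boundary values are later read off the extension of [H]. *)
Let tau y := expR (2 / alpha * ln (rho0 y)).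

Lemma tau_gt0 x : 0 < tau x. Proof. exact: expR_gt0. Qed.

Lemma tau_derive c x : O x -> is_derive x (evec c) tau (2 * tau x * U c x).
Proof.
move=> Ox; have r0 := rho0_pos Ox.
have h1 := Cinfty_is_derive c (Cinfty_open rho0_smooth) Ox Ox.2.
have h2 := is_derive_comp1 h1 (is_derive1_ln r0).
have h3 := is_deriveM (is_derive_cst (2 / alpha : R) x (evec c)) h2.
have h4 := is_derive_comp1 h3 (is_derive_expR _).
apply: is_derive_eq h4 _; rewrite /GRing.scale /= /cst /= mulr0 addr0.
rewrite -/(tau x) /U invfM; field.
by rewrite !gt_eqF.
Qed.

Lemma tau_smooth : Cinfty_on O tau.
Proof.
apply: (@alg_Cinfty _ _ (fun f => Cinfty_on O f \/ f = tau)) => //; last first.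
- by apply: alg_base; right.
- move=> f a [hf|->].
    exists (pd a f); first by apply: alg_base; left; apply: Cinfty_pd.
    by move=> x Ox _; apply: Cinfty_is_derive hf Ox Ox.2.
  exists (fun x => 2 * tau x * U a x); last by move=> x Ox _; apply: tau_derive.
  apply: alg_mul; first apply: alg_mul; first exact: alg_cst.
    by apply: alg_base; right.
  by apply: alg_base; left; apply: Upsilon_smooth.
- move=> f [/Cinfty_continuous//|->]; apply/subspace_continuousP => x Ox.
  have /subspace_continuousP/(_ x Ox) h := Cinfty_continuous (Cinfty_open rho0_smooth).
  apply: continuous_cvg; first exact: continuous_expR.
  apply: cvgM; first exact: cvg_cst.
  by apply: continuous_cvg h; apply: continuous_ln; apply: rho0_pos.
Qed.

Let kap y a b := tau y * (lam * g y a b + U a y * U b y).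
Let om y a := tau y * U a y.

(* The tractor metric [H], in the splitting given by the connection [Gb]. *)
Let H y : 'M[R]_(n.+1 + 1) := block_mx (\matrix_(a, b) kap y a b) (\col_a om y a)
  (\row_b om y b) (tau y)%:M.

(** The matrix of the tractor connection of [Gb] in direction [c]: connection coefficients, minus
    the Schouten tensor, and the tautological form. That [H] is parallel reads
    [dH = D H + H D^T]. *)
Let D c y : 'M[R]_(n.+1 + 1) := block_mx (\matrix_(a, k) Gb k c a y)
  (\col_a - schouten Gb c a y) (delta_mx 0 c) 0.

Lemma kap_sym x a b : O x -> kap x a b = kap x b a.
Proof. by move=> Ox; rewrite /kap (g_sym a b Ox) [U a x * _]mulrC. Qed.

Lemma sum_Gb c a (F : 'I_n.+1 -> R) x : O x -> \sum_k Gb k c a x * F k =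
  \sum_k Gam k c a x * F k + U c x * F a + U a x * F c.
Proof.
move=> Ox; rewrite -(sum_projective_change (fun k a b => Gam k a b x) (fun a => U a x)).
by apply: eq_bigr => k _; rewrite Gb_eq.
Qed.

Lemma om_derive c b x : O x -> is_derive x (evec c) (fun y => om y b)
  (\sum_k Gb k c b x * om x k - schouten Gb c b x * tau x + kap x b c).
Proof.
move=> Ox; have h := is_deriveM (tau_derive c Ox) (Upsilon_derive c b Ox).
apply: is_derive_eq h _; rewrite /GRing.scale /= sum_Gb // kap_sym //.
rewrite Upsilon_covariant_derivative // /om /kap.
have -> : \sum_k Gam k c b x * (tau x * U k x) = tau x * \sum_k Gam k c b x * U k x.
  by rewrite mulr_sumr; apply: eq_bigr => k _; rewrite mulrCA.
ring.
Qed.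

Lemma kap_derive c a b x : O x -> is_derive x (evec c) (fun y => kap y a b)
  (\sum_k Gb k c a x * kap x k b - schouten Gb c a x * om x b
   + (\sum_k Gb k c b x * kap x a k - schouten Gb c b x * om x a)).
Proof.
move=> Ox.
have h1 := is_deriveM (is_derive_cst lam x (evec c))
  (Cinfty_is_derive c (g_smooth a b) Ox Ox.2).
have h2 := is_deriveM (Upsilon_derive c a Ox) (Upsilon_derive c b Ox).
have h := is_deriveM (tau_derive c Ox) (is_deriveD h1 h2).
apply: is_derive_eq h _; rewrite /GRing.scale /= /cst /= mulr0 addr0 !sum_Gb //.
rewrite levi_civita_g // big_split /= !Upsilon_covariant_derivative // /om.
rewrite -[((fun=> lam) * _ + _) x]/(lam * g x a b + U a x * U b x).
have E1 : \sum_k Gam k c a x * kap x k b = tau x *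
    (lam * (\sum_k Gam k c a x * g x k b) + (\sum_k Gam k c a x * U k x) * U b x).
  rewrite mulrDr mulr_suml !mulr_sumr -big_split.
  by apply: eq_bigr => k _; rewrite /kap /=; ring.
have E2 : \sum_k Gam k c b x * kap x a k = tau x *
    (lam * (\sum_k Gam k c b x * g x a k) + (\sum_k Gam k c b x * U k x) * U a x).
  rewrite mulrDr mulr_suml !mulr_sumr -big_split.
  by apply: eq_bigr => k _; rewrite /kap /=; ring.
rewrite E1 E2 /kap (g_sym a c Ox).
move: (\sum_k _) (\sum_k _) (\sum_k _) (\sum_k _) => s1 s2 s3 s4.
move: (tau x) (U a x) (U b x) (U c x) (g x a b) (g x c a) (g x c b) => *; ring.
Qed.

Lemma Cinfty_metric i j : Cinfty_on O (fun y => H y i j).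
Proof.
have hk a b : Cinfty_on O (fun y => kap y a b).
  apply: CinftyM => //; first exact: tau_smooth.
  apply: CinftyD => //; apply: CinftyM => //; try exact: Upsilon_smooth.
  exact: Cinfty_cst.
have ho a : Cinfty_on O (fun y => om y a).
  by apply: CinftyM => //; [exact: tau_smooth|exact: Upsilon_smooth].
case: (split_ordP i) => a ->; case: (split_ordP j) => b ->.
- by apply: eq_Cinfty_on (hk a b) => // y _; rewrite block_mxEul mxE.
- by apply: eq_Cinfty_on (ho a) => // y _; rewrite block_mxEur mxE.
- by apply: eq_Cinfty_on (ho b) => // y _; rewrite block_mxEdl mxE.
- by apply: eq_Cinfty_on tau_smooth => // y _; rewrite block_mxEdr mxE !ord1.
Qed.

Lemma metric_derive c x i j : O x -> is_derive x (evec c) (fun y => H y i j)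
  ((D c x *m H x + H x *m (D c x)^T) i j).
Proof.
move=> Ox; rewrite /D /H tr_block_mx !mulmx_block add_block_mx.
case: (split_ordP i) => a ->; case: (split_ordP j) => b ->.
- rewrite block_mxEul (_ : (fun _ => _) = (fun y => kap y a b)); last first.
    by apply/funext => y; rewrite block_mxEul mxE.
  apply: is_derive_eq (kap_derive c a b Ox) _.
  rewrite !mxE !big_ord1 !mxE; congr (_ + _ + (_ + _)).
  + by apply: eq_bigr => k _; rewrite !mxE.
  + by rewrite mulNr.
  + by apply: eq_bigr => k _; rewrite !mxE mulrC.
  + by rewrite mulrN mulrC.
- rewrite block_mxEur (_ : (fun _ => _) = (fun y => om y a)); last first.
    by apply/funext => y; rewrite block_mxEur mxE.
  apply: is_derive_eq (om_derive c a Ox) _.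
  rewrite !mxE !big_ord1 !mxE !ord1 eqxx mulr1n mulNr.
  congr (_ + _ + _).
    by apply: eq_bigr => k _; rewrite !mxE.
  rewrite mulr0 addr0 -[LHS](sum_delta_sym (fun k => kap x a k) c).
  by apply: eq_bigr => k _; rewrite !mxE eqxx eq_sym.
- rewrite block_mxEdl (_ : (fun _ => _) = (fun y => om y b)); last first.
    by apply/funext => y; rewrite block_mxEdl mxE.
  apply: is_derive_eq (om_derive c b Ox) _.
  rewrite !mxE !big_ord1 !mxE !ord1 eqxx mulr1n mul0r addr0 addrC.
  congr (_ + _ + _).
  + by apply: eq_bigr => k _; rewrite !mxE mulrC.
  + by rewrite mulrN mulrC.
  + rewrite -[LHS](sum_delta_sym (fun k => kap x b k) c).
    by apply: eq_bigr => k _; rewrite !mxE eqxx eq_sym kap_sym // mulrC.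
- rewrite block_mxEdr (_ : (fun _ => _) = tau); last first.
    by apply/funext => y; rewrite block_mxEdr mxE !ord1.
  apply: is_derive_eq (tau_derive c Ox) _.
  rewrite !mxE !big_ord1 !mxE !ord1 mul0r mulr0 !addr0.
  have -> : \sum_j (delta_mx 0 c) 0 j * (\col_a0 om x a0) j 0 = om x c.
    transitivity (\sum_k om x k * (c == k)%:R); last exact: sum_delta_sym.
    by apply: eq_bigr => k _; rewrite !mxE eqxx eq_sym mulrC.
  have -> : \sum_j (\row_b0 om x b0) 0 j * (delta_mx 0 c)^T j 0 = om x c.
    transitivity (\sum_k om x k * (c == k)%:R); last exact: sum_delta_sym.
    by apply: eq_bigr => k _; rewrite !mxE eqxx eq_sym.
  by rewrite /om; ring.
Qed.

(** Completing the square with [U] shows that [H] is congruent, by unipotent matrices, to the block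
    sum of [tau lam g] and [tau]. *)
Lemma metric_unit x : O x -> H x \in unitmx.
Proof.
move=> Ox; pose u : 'cV[R]_n.+1 := \col_a U a x.
have -> : H x = block_mx 1%:M u 0 1%:M *m
    block_mx ((tau x * lam) *: g x) 0 0 (tau x)%:M *m block_mx 1%:M 0 u^T 1%:M.
  rewrite !mulmx_block !mul1mx !mulmx1 !mul0mx !mulmx0 !addr0 !add0r.
  rewrite mul_mx_scalar mul_scalar_mx; congr block_mx.
  - apply/matrixP => a b; rewrite !mxE big_ord1 !mxE /kap; ring.
  - by apply/matrixP => a b; rewrite !mxE.
  - by apply/matrixP => a b; rewrite !mxE.
have tn : tau x != 0 by rewrite gt_eqF // tau_gt0.
rewrite !unitmx_mul -andbA; apply/and3P; split.
- by rewrite unitmxE det_ublock !det1 mulr1 unitr1.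
- have := g_unit Ox; rewrite !unitmxE !unitfE => gn.
  by rewrite det_ublock detZ det_scalar1 !mulf_neq0 // expf_neq0 // mulf_neq0 // lam_neq0.
- by rewrite unitmxE det_lblock !det1 mulr1 unitr1.
Qed.

Let L y : 'M[R]_(n.+1 + 1) := invmx (H y).

Lemma Cinfty_inverse_metric i j : Cinfty_on O (fun y => L y i j).
Proof. by apply: Cinfty_invmx => //; [exact: Cinfty_metric|exact: metric_unit]. Qed.

(** Differentiating [H L = 1] gives [dL = - L dH L]; substituting the system for [H] leaves
    [- D^T L - L D]. *)
Lemma inverse_metric_derive c x i j : O x -> is_derive x (evec c) (fun y => L y i j)
  ((- (D c x)^T *m L x + L x *m (- (D c x)^T)^T) i j).
Proof.
move=> Ox; pose dL : 'M[R]_(n.+1 + 1) := \matrix_(i, j) pd c (fun y => L y i j) x.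
pose dH := D c x *m H x + H x *m (D c x)^T.
have hL (p q : 'I_(n.+1 + 1)) : is_derive x (evec c) (fun y => L y p q) (dL p q).
  by rewrite mxE; apply: Cinfty_is_derive (Cinfty_inverse_metric p q) Ox Ox.2.
have E : dH *m L x + H x *m dL = 0.
  apply/matrixP => p q.
  have h1 : is_derive x (evec c) (fun y => \sum_m H y p m * L y m q)
      (\sum_m (H x p m * dL m q + L x m q * dH p m)).
    by apply: is_derive_bigsum => m _; exact: (is_deriveM (metric_derive c p m Ox) (hL m q)).
  have h2 : is_derive x (evec c) (fun y => \sum_m H y p m * L y m q) (0 : R).
    apply: near_eq_is_derive (is_derive_cst ((p == q)%:R : R) x (evec c)).
    apply: filterS (interior_near Oo Ox Ox.2) => y [Oy _].
    have /matrixP/(_ p q) := mulmxV (metric_unit Oy).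
    by rewrite !mxE => <-.
  have h12 : \sum_m (H x p m * dL m q + L x m q * dH p m) = 0.
    by have [_ <-] := h1; have [_ ->] := h2.
  rewrite !mxE -big_split -[RHS]h12 /=.
  by apply: eq_bigr => m _; rewrite [LHS]addrC [dH _ _ * _]mulrC.
have HL : H x *m L x = 1%:M by apply: mulmxV; apply: metric_unit.
have LH : L x *m H x = 1%:M by apply: mulVmx; apply: metric_unit.
suff <- : dL = - (D c x)^T *m L x + L x *m (- (D c x)^T)^T by [].
have -> : dL = - (L x *m dH *m L x).
  have : L x *m (dH *m L x + H x *m dL) = 0 by rewrite E mulmx0.
  rewrite mulmxDr [L x *m (H x *m _)]mulmxA LH mul1mx mulmxA => /eqP.
  by rewrite addrC addr_eq0 => /eqP.
rewrite /dH mulmxDr mulmxDl [L x *m (H x *m _)]mulmxA LH mul1mx.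
rewrite -!mulmxA HL mulmx1 linearN /= trmxK mulNmx mulmxN opprD addrC.
by [].
Qed.

Lemma Cinfty_transport c i j : Cinfty_on V (fun y => D c y i j).
Proof.
case: (split_ordP i) => a ->; case: (split_ordP j) => b ->.
- by apply: eq_Cinfty_on (Gb_smooth b c a) => // y _; rewrite block_mxEul mxE.
- apply: eq_Cinfty_on (CinftyN Vo (Cinfty_schouten c a Vo Gb_smooth)) => // y _.
  by rewrite block_mxEur mxE.
- by apply: eq_Cinfty_on (Cinfty_cst Vo ('e_c 0 b)) => // y _; rewrite block_mxEdl !ord1.
- by apply: eq_Cinfty_on (Cinfty_cst Vo 0) => // y _; rewrite block_mxEdr mxE.
Qed.

Lemma transport_bounded c y i j : V y -> `|D c y i j| <= C.
Proof.
move=> Vy; case: (split_ordP i) => a ->; case: (split_ordP j) => b ->.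
- by rewrite block_mxEul mxE; apply: Gb_bounded.
- by rewrite block_mxEur mxE normrN; apply: schouten_bounded.
- rewrite block_mxEdl mxE; case: (_ && _); rewrite ?normr1 ?normr0 //.
  exact: le_trans C1.
- by rewrite block_mxEdr mxE normr0; apply: le_trans C1.
Qed.

Lemma tau_limit x r : V x -> x 0 ord0 = 0 -> 0 < r ->
  exists2 d : R, 0 < d & forall y, O y -> `|y - x| < d -> tau y < r.
Proof.
move=> Vx x_0 r0.
have := @powR_cvg0 R (2 / alpha); rewrite divr_gt0 // => /(_ isT).
move=> /cvgrPdist_lt/(_ r r0)/nbhs_ballP[d /= d0 hd].
have /continuous_onP/(_ x Vx d d0)[t t0 ht] := Cinfty_continuous rho0_smooth.
exists t => // y Oy yt; have yp := rho0_pos Oy.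
have := ht y (open_half_box Oy) yt; rewrite (rho0_vanishing Vx x_0) subr0 => yd.
have := hd (rho0 y); rewrite -ball_normE /= sub0r normrN => /(_ yd yp).
rewrite sub0r normrN gtr0_norm ?powR_gt0 //.
by rewrite /powR gt_eqF.
Qed.

(** With [rho = v tau], the singular term [v tau U U / lam] occurs in [rho g] and in
    [d rho ^ 2 / (4 lam rho)] with opposite signs. What remains is polynomial in [kappa], [tau],
    [v], [v^-1] and first derivatives. *)
Theorem chart_asymptotics (rho : 'rV[R]_n.+1 -> R) :
  Cinfty_on V rho -> vanishing x0 e rho ->
  (forall x, V x -> x 0 ord0 = 0 -> pd ord0 rho x != 0) ->
  (forall x, O x -> rho x != 0) ->
  exists K : 'rV[R]_n.+1 -> 'M[R]_n.+1,
  [/\ forall a b, Cinfty_on V (fun y => K y a b),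
      forall x a b, O x -> K x a b = rho x * g x a b
        + (4 * lam)^-1 * ((rho x)^-1 * (pd a rho x * pd b rho x)) &
      forall x, V x -> x 0 ord0 = 0 -> nondegenerate_on (@boundary_vectors R n) (K x)].
Proof.
move=> rho_smooth rho_van rho_pd rho_neq0.
have hx0 : half_space x0 by rewrite /half_space /= x00.
have C0 : 0 <= C by apply: le_trans C1.
have [Hb [HbE Hbs]] : exists Hb : 'rV[R]_n.+1 -> 'M[R]_(n.+1 + 1),
    (forall w, O w -> Hb w = H w) /\ forall i j, Cinfty_on V (fun y => Hb y i j).
  apply: (@system_extension R n x0 e _ H D C) => //.
  - by move=> a w i j Ow; apply: metric_derive.
  - by move=> a w i j Ow; apply: transport_bounded; apply: open_half_box.
  - exact: Cinfty_transport.
have E (M : 'M[R]_(n.+1 + 1)) i j : (- M^T) i j = - M j i by rewrite !mxE.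
have [Lb [LbE Lbs]] : exists Lb : 'rV[R]_n.+1 -> 'M[R]_(n.+1 + 1),
    (forall w, O w -> Lb w = L w) /\ forall i j, Cinfty_on V (fun y => Lb y i j).
  apply: (@system_extension R n x0 e _ L (fun c y => - (D c y)^T) C) => //.
  - by move=> a w i j Ow; apply: inverse_metric_derive.
  - move=> a w i j Ow; rewrite E normrN.
    by apply: transport_bounded; apply: open_half_box.
  - move=> a i j.
    by apply: (eq_Cinfty_on Vo _ (CinftyN Vo (Cinfty_transport a j i))) => y _; rewrite E.
have HL x : V x -> Hb x *m Lb x = 1%:M.
  move=> Vx; apply/matrixP => p q; rewrite !mxE.
  apply: (eq_on_half_box (f := fun y => \sum_r Hb y p r * Lb y r q)
    (h := fun=> (p == q)%:R)) => //.
  - apply: Cinfty_continuous; apply: Cinfty_sum => // r _; exact: CinftyM.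
  - apply: Cinfty_continuous; exact: Cinfty_cst.
  - move=> y Oy; have /matrixP/(_ p q) := mulmxV (metric_unit Oy).
    by rewrite !mxE => <-; rewrite HbE // LbE.
(* [top] indexes the row and column of [tau], [inj a] those of the coordinate directions. *)
pose top := rshift n.+1 (ord0 : 'I_1); pose inj a : 'I_(n.+1 + 1) := lshift 1 a.
pose tb y := Hb y top top.
have tbE x : O x -> tb x = tau x.
  by move=> Ox; rewrite /tb HbE // block_mxEdr mxE.
have obE x a : O x -> Hb x (inj a) top = om x a.
  by move=> Ox; rewrite HbE // block_mxEur mxE.
have kbE x a b : O x -> Hb x (inj a) (inj b) = kap x a b.
  by move=> Ox; rewrite HbE // block_mxEul mxE.
have ob_sym x a : V x -> Hb x top (inj a) = Hb x (inj a) top.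
  apply: (eq_on_half_box (f := fun y => Hb y top (inj a))
    (h := fun y => Hb y (inj a) top)); try exact: Cinfty_continuous.
  by move=> y Oy; rewrite obE // HbE // block_mxEdl mxE.
have tb_van : vanishing x0 e tb.
  move=> x Vx x_0; apply/eqP; rewrite -normr_le0; apply/ler_addgt0Pr => r r0.
  rewrite add0r; have r2 : 0 < r / 2 by rewrite divr_gt0.
  have [d1 d10 h1] := tau_limit Vx x_0 r2.
  have /continuous_onP/(_ x Vx _ r2)[d2 d20 h2] := Cinfty_continuous (Hbs top top).
  have d0 : 0 < Num.min d1 d2 by rewrite lt_min d10.
  have [t /andP[t0 td] ht] := push_half_box Vx d0.
  have xt : `|x + t *: evec ord0 - x| < Num.min d1 d2.
    rewrite [x + _]addrC addrK; apply: le_lt_trans (norm_scale_evec _ _) _.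
    by rewrite gtr0_norm.
  move: xt; rewrite lt_min => /andP[xt1 xt2].
  have := h2 _ (open_half_box ht) xt2; have := h1 _ ht xt1.
  rewrite -!/(tb _) tbE //; have := tau_gt0 (x + t *: evec ord0).
  move: (tau _) (tb x) => p q; rewrite ltr_norml ler_norml => ? ? /andP[? ?].
  by apply/andP; split; lra.
have pd_tb c x : V x -> pd c tb x = 2 * Hb x (inj c) top.
  apply: (eq_on_half_box (f := pd c tb) (h := fun y => 2 * Hb y (inj c) top)).
  - exact: Cinfty_continuous (Cinfty_pd c (Hbs top top)).
  - apply: Cinfty_continuous; apply: CinftyM => //; exact: Cinfty_cst.
  - move=> y Oy; rewrite (eq_pd c Oo Oy tbE) (pd_val Oy.2 (tau_derive c Oy)) obE //.
    by rewrite /om mulrA.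
have ob_tangent x c : V x -> x 0 ord0 = 0 -> c != ord0 -> Hb x (inj c) top = 0.
  move=> Vx x_0 c0; have := vanishing_pd c0 tb_van Vx x_0.
  by rewrite pd_tb // => /eqP; rewrite mulf_eq0 pnatr_eq0 /= => /eqP.
(* If the normal component of [omega] vanished too, the last row of the invertible matrix [Hb x]
   would be zero. *)
have ob_normal x : V x -> x 0 ord0 = 0 -> Hb x (inj ord0) top != 0.
  move=> Vx x_0; apply/eqP => o0; have /matrixP/(_ top top) := HL x Vx.
  rewrite !mxE eqxx big_split_ord /= big_ord1 -/top -/(tb x) tb_van // mul0r addr0.
  rewrite big1 => [/eqP|a _]; first by rewrite eq_sym oner_eq0.
  rewrite -/(inj a) ob_sym //; have [->|a0] := eqVneq a ord0; first by rewrite o0 mul0r.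
  by rewrite ob_tangent // mul0r.
have bd x : V x -> ~~ (0 < x 0 ord0) -> x 0 ord0 = 0.
  by move=> Vx; rewrite -leNgt => xn; apply/eqP; rewrite eq_le xn; apply: Vo.1.
(* Both [tb] and [rho] are the normal coordinate times a smooth factor that never vanishes, so their
   ratio [v] is smooth and non-vanishing. *)
have [A [As Aeq Abd]] := hadamard x00 (Hbs top top : Cinfty_on V tb) tb_van.
have [B [Bs Beq Bbd]] := hadamard x00 rho_smooth rho_van.
have An x : V x -> A x != 0.
  move=> Vx; have [xp|/(bd x Vx) x_0] := boolP (0 < x 0 ord0); last first.
    by rewrite Abd // pd_tb // mulf_neq0 ?ob_normal // pnatr_eq0.
  have Ox : O x by case: Vx.
  have : tb x != 0 by rewrite tbE // gt_eqF // tau_gt0.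
  by rewrite -/(tb _) Aeq // mulf_eq0 negb_or => /andP[].
have Bn x : V x -> B x != 0.
  move=> Vx; have [xp|/(bd x Vx) x_0] := boolP (0 < x 0 ord0); last first.
    by rewrite Bbd // rho_pd.
  have Ox : O x by case: Vx.
  have := rho_neq0 x Ox.
  by rewrite Beq // mulf_eq0 negb_or => /andP[].
pose v y := B y * (A y)^-1.
have vs : Cinfty_on V v by apply: CinftyM => //; apply: CinftyV.
have vn x : V x -> v x != 0.
  by move=> Vx; rewrite mulf_neq0 ?invr_eq0 ?Bn ?An.
have rhoE x : V x -> rho x = v x * tb x.
  move=> Vx; rewrite Beq // [tb x]Aeq // /v; field.
  exact: An.
have ln0 := lam_neq0.
pose K y : 'M[R]_n.+1 := \matrix_(a, b) (v y * Hb y (inj a) (inj b) * lam^-1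
  + (pd a tb y * pd b v y + pd a v y * pd b tb y) * (4 * lam)^-1
  + tb y * pd a v y * pd b v y * (v y)^-1 * (4 * lam)^-1).
have pdv a : Cinfty_on V (pd a v) by apply: Cinfty_pd.
have pdt a : Cinfty_on V (pd a tb) by apply: Cinfty_pd; apply: Hbs.
exists K; split.
- move=> a b; apply: (eq_Cinfty_on (f := fun y => v y * Hb y (inj a) (inj b) * lam^-1
    + (pd a tb y * pd b v y + pd a v y * pd b tb y) * (4 * lam)^-1
    + tb y * pd a v y * pd b v y * (v y)^-1 * (4 * lam)^-1)) => //.
    by move=> y _; rewrite mxE.
  apply: CinftyD => //; first apply: CinftyD => //.
  + by apply: CinftyM => //; [apply: CinftyM|apply: Cinfty_cst].
  + apply: CinftyM => //; last exact: Cinfty_cst.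
    by apply: CinftyD => //; apply: CinftyM.
  + apply: CinftyM => //; last exact: Cinfty_cst.
    apply: CinftyM => //; last exact: CinftyV.
    by apply: CinftyM => //; apply: CinftyM => //; apply: Hbs.
- move=> x a b Ox; have Vx : V x by apply: open_half_box.
  have pdr c : pd c rho x = v x * pd c tb x + tb x * pd c v x.
    rewrite (eq_pd c Vo Vx rhoE); apply: pd_val Ox.2 _.
    apply: is_deriveM; first exact: Cinfty_is_derive vs Vx Ox.2.
    exact: Cinfty_is_derive (Hbs top top) Vx Ox.2.
  rewrite mxE kbE // !pdr rhoE // !pd_tb // !obE // tbE // /kap /om.
  have := vn x Vx; have := tau_gt0 x.
  move: (v x) (tau x) (U a x) (U b x) (pd a v x) (pd b v x) (g x a b) => p q Ua Ub va vb gab q0 pn.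
  have qn : q != 0 by rewrite gt_eqF.
  by move: lam ln0 => r rn; field; rewrite rn qn pn.
- move=> x Vx x_0 w w0 hw.
  (* On tangent vectors at the boundary [K] reduces to [v / lam] times [kappa], because [tau] and
     the tangential derivatives of [tau] vanish there. *)
  have kbw (u : 'rV[R]_n.+1) : u 0 ord0 = 0 ->
      \sum_b (\sum_a w 0 a * Hb x (inj a) (inj b)) * u 0 b = 0.
    move=> u0; have := hw u u0; rewrite !mxE.
    rewrite (eq_bigr (fun b => (v x / lam) *
        ((\sum_a w 0 a * Hb x (inj a) (inj b)) * u 0 b))); last first.
      move=> b _; rewrite !mxE; have [->|b0] := eqVneq b ord0.
        by rewrite u0 !mulr0.
      rewrite mulrA; congr (_ * _); rewrite mulr_sumr; apply: eq_bigr => a _.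
      have [->|a0] := eqVneq a ord0; first by rewrite w0 !mul0r mulr0.
      rewrite !mxE -/(inj a) !pd_tb // !ob_tangent // tb_van //; ring.
    rewrite -mulr_sumr => /eqP; rewrite mulf_eq0 => /orP[|/eqP //].
    by rewrite mulf_eq0 invr_eq0 (negPf ln0) (negPf (vn x Vx)).
  (* The last entry [- s] makes the normal component of [r *m Hb x] vanish. The tangential
     components vanish by [kbw], the last one because [w] is tangent; so [r] lies in the kernel of
     an invertible matrix. *)
  pose s := (\sum_a w 0 a * Hb x (inj a) (inj ord0)) / Hb x (inj ord0) top.
  have on := ob_normal x Vx x_0.
  pose r : 'rV[R]_(n.+1 + 1) := row_mx w (- s)%:M.
  have rH : r *m Hb x = 0.
    apply/rowP => j; rewrite !mxE big_split_ord /= big_ord1 -/top row_mxEr mxE mulr1n.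
    under eq_bigr do rewrite row_mxEl.
    case: (split_ordP j) => b ->.
      rewrite -/(inj b) ob_sym //; have [->|b0] := eqVneq b ord0.
        by rewrite /s; field.
      rewrite ob_tangent // mulr0 addr0.
      have S1 : (delta_mx 0 b : 'rV[R]_n.+1) 0 ord0 = 0.
        by rewrite mxE eqxx eq_sym (negPf b0).
      rewrite -[RHS](kbw _ S1).
      transitivity (\sum_c (\sum_a w 0 a * Hb x (inj a) (inj c)) * (c == b)%:R).
        by rewrite sum_delta.
      by apply: eq_bigr => c _; rewrite mxE eqxx.
    rewrite ord1 -/top -/(tb x) tb_van // mulr0 addr0; apply: big1 => a _.
    have [->|a0] := eqVneq a ord0; first by rewrite w0 mul0r.
    by rewrite -/(inj a) ob_tangent // mulr0.
  have r0 : r = 0 by rewrite -[r]mulmx1 -(HL x Vx) mulmxA rH mul0mx.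
  apply/rowP => a; have /rowP/(_ (lshift 1 a)) := r0.
  by rewrite row_mxEl !mxE.
Qed.

End ChartGeometry.

(** * From charts to the manifold *)

Local Notation coord := Defs.coord.
Local Notation index := Defs.index.
Local Notation jacobian := Defs.jacobian.

Section ManifoldAssembly.
Context {R : realType} {n : nat}.
Implicit Types (x y z w : 'rV[R]_n.+1) (a b c k l : 'I_n.+1).

Lemma locally_bounded (A : set 'rV[R]_n.+1) (I : finType)
    (f : I -> 'rV[R]_n.+1 -> R) x :
  (forall i, Cinfty_on A (f i)) -> A x ->
  exists2 d : R, 0 < d & exists2 C : R, 1 <= C &
    forall i y, A y -> `|y - x| < d -> `|f i y| <= C.
Proof.
move=> hf Ax.
have [d d0 hd] := continuous_on_family (fun i : I => Cinfty_continuous (hf i)) Ax ltr01.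
exists d => //; exists (1 + \sum_i `|f i x|).
  by rewrite lerDl; apply: sumr_ge0.
move=> i y Ay yd; rewrite -(subrK (f i x) (f i y)).
apply: le_trans (ler_normD _ _) _; apply: lerD; first by apply: ltW; apply: hd.
by rewrite (bigD1 i) //= lerDl; apply: sumr_ge0.
Qed.

Lemma eq_on_rel_open (A : set 'rV[R]_n.+1) (f h : 'rV[R]_n.+1 -> R) : rel_open A ->
  {within A, continuous f} -> {within A, continuous h} ->
  (forall x, A x -> 0 < x 0 ord0 -> f x = h x) -> forall x, A x -> f x = h x.
Proof.
move=> Ao fc hc fh x Ax; have [e e0 he] := Ao.2 x Ax.
apply: (@eq_on_half_box R n x e f h).
- exact: continuous_onS fc.
- exact: continuous_onS hc.
- by move=> y Oy; apply: fh; [apply: he; apply: open_half_box|case: Oy].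
- by split; [rewrite subrr normr0|apply: Ao.1].
Qed.

(** Fermat's criterion on the coordinate line through [x]; it serves [boundary_coord]. *)
Lemma interior_min_pd (A : set 'rV[R]_n.+1) f x a : rel_open A -> Cinfty_on A f ->
  A x -> 0 < x 0 ord0 -> (forall y, A y -> f x <= f y) -> pd a f x = 0.
Proof.
move=> Ao hf Ax x0 fx; have [e e0 he] := Ao.2 x Ax.
pose r := Num.min e (x 0 ord0).
have r0 : 0 < r by rewrite lt_min e0.
have inA t : t \in `]- r, r[ -> A (x + t *: evec a) /\ 0 < (x + t *: evec a) 0 ord0.
  rewrite in_itv /= -ltr_norml lt_min => /andP[te tx].
  have p : 0 < (x + t *: evec a) 0 ord0.
    rewrite shift_coord; move: tx; rewrite ltr_norml => /andP[? ?].
    by case: (_ == _); rewrite ?mulr1n ?mulr0n; lra.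
  split=> //; apply: he; split; last exact: ltW.
  by rewrite [x + _]addrC addrK; apply: le_lt_trans (norm_scale_evec _ _) te.
have dphi t : t \in `]- r, r[ ->
    is_derive t 1 (fun s : R => f (x + s *: evec a)) (pd a f (x + t *: evec a)).
  by move=> /inA[At tp]; apply: is_derive_slice; apply: Cinfty_is_derive hf At tp.
have r00 : 0 \in `]- r, r[ by rewrite in_itv /= oppr_lt0 r0.
have [_ d0] : is_derive (0 : R) 1 (fun s : R => f (x + s *: evec a)) 0.
  apply: (@derive1_at_min _ _ (- r) r) => //.
  - by rewrite ge0_cp // ltW.
  - by move=> t /dphi[].
  - by move=> t /inA[At _]; rewrite scale0r addr0; apply: fx.
by have [_] := dphi 0 r00; rewrite d0 scale0r addr0.
Qed.

Lemma congruence_entry (A B : 'M[R]_n.+1) a b :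
  (A *m B *m A^T) a b = \sum_k (\sum_l A a l * B l k) * A b k.
Proof. by rewrite !mxE; apply: eq_bigr => k _; rewrite !mxE. Qed.

Lemma unitmx_nondegenerate (m : 'M[R]_n.+1) : nondegenerate_on setT m -> m \in unitmx.
Proof.
move=> h; apply/negP => /negP; rewrite unitmxE unitfE negbK => /det0P[v v0 vm].
by case/eqP: v0; apply: h => // w _; rewrite vm mul0mx mxE.
Qed.

Variable M : bd_manifold R n.
Implicit Types (i j : index M) (p q : M) (A W : set M).

Let cinv i := chart_inv (atlas i).
Let img i A := coord i @` (A `&` dom i).

Lemma open_dom i : open (dom i).
Proof. exact: chart_dom_open. Qed.

Lemma coordK i p : dom i p -> cinv i (coord i p) = p.
Proof. exact: chart_mapK. Qed.

Lemma imgP i A y : img i A y ->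
  [/\ A (cinv i y), dom i (cinv i y) & coord i (cinv i y) = y].
Proof. by move=> [p [Ap dp] <-]; rewrite coordK. Qed.

Lemma img_coord i A p : A p -> dom i p -> img i A (coord i p).
Proof. by move=> Ap dp; exists p. Qed.

(** The chart image is relatively open in the half-space, and continuity of the inverse chart keeps
    nearby points in [A]. *)
Lemma rel_open_img i A : open A -> rel_open (img i A).
Proof.
move=> Ao; have [V Vo hV] := chart_img_open (atlas i).
have imgV y : (chart_map (atlas i) @` chart_dom (atlas i)) y <-> V y /\ half_space y.
  by rewrite hV.
split.
  move=> y [p [_ dp] <-].
  by have [] : V (coord i p) /\ half_space (coord i p) by apply/imgV; exists p.
move=> x [p [Ap dp] xp].
have ix : (chart_map (atlas i) @` chart_dom (atlas i)) x by exists p.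
have px : chart_inv (atlas i) x = p by rewrite -xp; apply: coordK.
have /subspace_continuousP/(_ x ix) := @chart_inv_continuous _ _ _ (atlas i).
have nA : nbhs (chart_inv (atlas i) x) A by rewrite px; apply: open_nbhs_nbhs; split.
move=> /(_ A nA)/within_nbhsP[d d0 hd].
have /nbhs_ballP[r /= r0 hr] : nbhs x V by apply: open_nbhs_nbhs; split=> //; apply: ((imgV x).1 ix).1.
exists (Num.min d r); first by rewrite lt_min d0.
move=> y [+ hy]; rewrite lt_min => /andP[yd yr].
have iy : (chart_map (atlas i) @` chart_dom (atlas i)) y.
  by apply: (imgV y).2; split=> //; apply: hr; rewrite -ball_normE /= distrC.
have Ay : A (chart_inv (atlas i) y) by apply: hd iy yd.
case: iy => q dq qy; exists q => //; split=> //.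
by move: Ay; rewrite -qy chart_mapK.
Qed.

Lemma coord_ge0 i p : dom i p -> 0 <= coord i p 0 ord0.
Proof.
have [V _ hV] := chart_img_open (atlas i) => dp.
have : (chart_map (atlas i) @` chart_dom (atlas i)) (coord i p) by exists p.
by rewrite hV => -[].
Qed.

Lemma interior_coord i p : manifold_interior p -> dom i p -> 0 < coord i p 0 ord0.
Proof.
move=> ip dp; rewrite lt_neqAle coord_ge0 // andbT eq_sym; apply/eqP => h.
by apply: ip; exists i.
Qed.

Lemma partialE i a (f : M -> R) A y : img i A y ->
  partial i a f (cinv i y) = pd a (f \o cinv i) y.
Proof. by move=> /imgP[_ _ E]; rewrite /partial E. Qed.

(** * Defining functions in charts *)

Section DefiningFunction.
Variables (W : set M) (rho : M -> R).
Hypothesis rho_def : local_defining_function W rho.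

(** [manifold_boundary] only asks for some chart sending [p] to the hyperplane. If another chart
    sent [p] to the open half-space, [rho] would have an interior minimum there, so its differential
    would vanish, contrary to its being a defining function. *)
Lemma boundary_coord i p : W p -> dom i p ->
  manifold_boundary p -> coord i p 0 ord0 = 0.
Proof.
have [Wo rs rge r0 dr] := rho_def => Wp dp bp.
apply/eqP; apply/negP => /negP c0.
have cp : 0 < coord i p 0 ord0 by rewrite lt_neqAle eq_sym c0 coord_ge0.
case/eqP: (dr i p Wp bp dp); apply/rowP => a; rewrite !mxE.
apply: (interior_min_pd a (rel_open_img i Wo) (rs i) (img_coord Wp dp) cp).
move=> y /imgP[Wy dy _] /=.
rewrite (_ : chart_inv _ _ = p) ?(proj2 (r0 p Wp) bp); last exact: coordK.
exact: rge.
Qed.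

Lemma img_interior i y : img i W y -> 0 < y 0 ord0 -> manifold_interior (cinv i y).
Proof.
move=> /imgP[Wy dy E] y0 /(boundary_coord Wy dy).
by rewrite E => y00; rewrite y00 ltxx in y0.
Qed.

Lemma img_boundary i y : img i W y -> y 0 ord0 = 0 -> manifold_boundary (cinv i y).
Proof. by move=> /imgP[Wy dy E] y0; exists i; rewrite E. Qed.

Lemma defining_gt0 p : W p -> manifold_interior p -> 0 < rho p.
Proof.
have [Wo rs rge r0 dr] := rho_def => Wp ip.
by rewrite lt_neqAle eq_sym rge // andbT; apply/eqP => /(r0 p Wp).
Qed.

(** The tangential derivatives of [rho] vanish along the boundary, so the non-zero differential must
    be carried by the normal derivative. *)
Lemma defining_pd i y e : 0 < e -> half_box y e `<=` img i W -> y 0 ord0 = 0 ->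
  forall z, half_box y e z -> z 0 ord0 = 0 -> pd ord0 (rho \o cinv i) z != 0.
Proof.
have [Wo rs rge r0 dr] := rho_def => e0 sub y0 z hz z0; apply/eqP => h.
have [Wz dz E] := imgP (sub _ hz); have bz := img_boundary (sub _ hz) z0.
case/eqP: (dr i _ Wz bz dz); apply/rowP => a; rewrite !mxE (partialE _ _ (sub _ hz)).
have [->|a0] := eqVneq a ord0; first exact: h.
apply: (vanishing_pd (e := e) a0 _ hz z0) => u hu u0 /=.
have [Wu du _] := imgP (sub _ hu).
by apply/(r0 _ Wu); apply: img_boundary (sub _ hu) u0.
Qed.

Lemma differential_change i j p : W p -> manifold_interior p -> dom i p -> dom j p ->
  differential rho i p = differential rho j p *m (jacobian i j p)^T.
Proof.
have [Wo rs rge r0 dr] := rho_def => Wp ip di dj.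
have Ao : rel_open (img i (W `&` dom j)).
  by apply: rel_open_img; apply: openI => //; apply: open_dom.
have Ap : img i (W `&` dom j) (coord i p) by apply: img_coord.
have x0 := interior_coord ip di.
apply/rowP => a; rewrite !mxE /partial.
rewrite (eq_pd a Ao Ap (g := (rho \o cinv j) \o (fun y => coord j (cinv i y)))).
  apply: (pd_val x0).
  have := @chain_rule R n _ _ (rho \o cinv j) (fun y => coord j (cinv i y))
    (fun c => partial i a (fun q => coord j q 0 c) p) a (coord i p) Ao
    (rel_open_img j Wo) _ (rs j) Ap x0.
  rewrite /= coordK // => H; apply: is_derive_eq.
    apply: H => [y /imgP[[Wy dy] _ _]|c]; first exact: img_coord.
    apply: (Cinfty_is_derive (U := img i (W `&` dom j))) => //.
    apply: Cinfty_onS (atlas_compatible i j c) => y [q [[_ qj] qi] <-].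
    by exists q.
  by apply: eq_bigr => c _; rewrite !mxE.
by move=> y /imgP[[_ dy] _ _] /=; rewrite coordK.
Qed.

End DefiningFunction.

(** * Extending the form from charts to the manifold *)

Section Einstein.
Variables (g : tensor02 M) (nabla : connection M) (S : R).
Hypotheses (g_metric : pseudo_riemannian g) (nabla_lc : levi_civita g nabla).
Hypothesis g_compact : projectively_compact nabla.
Hypothesis g_einstein : einstein_with_scalar_curvature g nabla S.
Hypothesis S_neq0 : S != 0.

Lemma ricci_dim1 i p : n = 0%N -> ricci nabla i p = 0.
Proof.
move=> n0; have E (a b : 'I_n.+1) : a = b.
  by apply/ord_inj; case: a b => a ha [b hb] /=; rewrite n0 in ha hb; lia.
apply/matrixP => b c; rewrite !mxE; apply: big1 => k _.
rewrite /riemann (E k b) subrr add0r; apply: big1 => l _.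
by rewrite subrr.
Qed.

(** In dimension one the Ricci tensor vanishes by antisymmetry of the curvature, against [S != 0].
    This justifies dividing by [n]. *)
Lemma einstein_dim_gt0 i p : manifold_interior p -> dom i p -> (0 < n)%N.
Proof.
move=> ip dp; rewrite lt0n; apply/eqP => n0.
have [h _] := g_einstein ip dp; move/eqP: S_neq0; apply; rewrite -h.
by rewrite /scalar_curvature ricci_dim1 // mulmx0 mxtrace0.
Qed.

Variables (W : set M) (rho : M -> R).
Hypothesis rho_def : local_defining_function W rho.

Let Wo : open W. Proof. by case: rho_def. Qed.

Let hform i p : 'M[R]_n.+1 := rho p *: g i p
  + (n%:R * n.+1%:R / (4%:R * S)) *: ((rho p)^-1 *: differential_sq rho i p).

Lemma local_extension i p : W p -> dom i p -> manifold_boundary p ->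
  exists2 e : R, 0 < e & exists K : 'rV[R]_n.+1 -> 'M[R]_n.+1,
  [/\ half_box (coord i p) e `<=` img i W,
      forall a b, Cinfty_on (half_box (coord i p) e) (fun y => K y a b),
      forall y, open_box (coord i p) e y -> K y = hform i (cinv i y) &
      forall y, half_box (coord i p) e y -> y 0 ord0 = 0 ->
        nondegenerate_on (@boundary_vectors R n) (K y)].
Proof.
move=> Wp dp bp; have [alpha alpha0 /(_ p bp)] := g_compact.
move=> [W0 [rho0 [Gbar [rho0_def W0p [_ _ Gb_smooth] Gb_eq]]]].
have [W0o rs0 rge0 r00 dr0] := rho0_def; have [_ rs rge r0 dr] := rho_def.
set x := coord i p; have x0 : x 0 ord0 = 0 by apply: boundary_coord rho_def _ _ _ _ _.
have Uo : rel_open (img i (W `&` W0)) by apply: rel_open_img; apply: openI.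
have Ux : img i (W `&` W0) x by apply: img_coord.
have subW : img i (W `&` W0) `<=` img i W.
  by move=> y [q [[Wq _] dq] <-]; exists q.
have subW0 : img i (W `&` W0) `<=` img i W0.
  by move=> y [q [[_ Wq] dq] <-]; exists q.
pose Gb k a b y := Gbar i (cinv i y) k a b.
have Gbs k a b : Cinfty_on (img i (W `&` W0)) (Gb k a b).
  apply: Cinfty_onS (Gb_smooth i k a b i) => y [q [[_ Wq] dq] <-].
  by exists q.
have [d1 d10 [C1 C11 hC1]] := locally_bounded
  (f := fun u : 'I_n.+1 * 'I_n.+1 * 'I_n.+1 => Gb u.1.1 u.1.2 u.2)
  (fun u => Gbs _ _ _) Ux.
have [d2 d20 [C2 C21 hC2]] := locally_bounded
  (f := fun u : 'I_n.+1 * 'I_n.+1 => schouten Gb u.1 u.2)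
  (fun u => Cinfty_schouten u.1 u.2 Uo Gbs) Ux.
have [d3 d30 h3] := Uo.2 x Ux.
(* The box lies in the domains of [rho] and [rho0], and the connection and its Schouten tensor are
   bounded on it by local boundedness at [x]. *)
pose e := Num.min d3 (Num.min d1 d2).
have e0 : 0 < e by rewrite !lt_min d10 d20 d30.
have subU : half_box x e `<=` img i (W `&` W0).
  by move=> y [+ hy]; rewrite lt_min => /andP[yd _]; apply: h3; split.
have bd1 y : half_box x e y -> `|y - x| < d1.
  by move=> [+ _]; rewrite !lt_min => /and3P[].
have bd2 y : half_box x e y -> `|y - x| < d2.
  by move=> [+ _]; rewrite !lt_min => /and3P[].
have inter y : open_box x e y -> manifold_interior (cinv i y).
  by move=> Oy; apply: (img_interior rho_def); [apply: subW; apply: subU; apply: open_half_box|case: Oy].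
have domy y : half_box x e y -> dom i (cinv i y) by move=> /subU/imgP[].
have cy y : half_box x e y -> coord i (cinv i y) = y by move=> /subU/imgP[].
have [[g_sym _ g_smooth] g_nondeg] := g_metric.
have [[Gam_sym _ Gam_smooth] lc] := nabla_lc.
have OI y : open_box x e y -> (coord i @` ((@manifold_interior R n M `&` dom i) `&` dom i)) y.
  move=> Oy; have hy := open_half_box Oy.
  by exists (cinv i y); [split; [split; [apply: inter|apply: domy]|apply: domy]|apply: cy].
have C12 : 1 <= Num.max C1 C2 by rewrite le_max C11.
have [y0 Oy0] := center_pushed e0 (Uo.1 _ Ux).
have n0 := einstein_dim_gt0 (inter _ Oy0) (domy _ (open_half_box Oy0)).
have H1 a b : Cinfty_on (open_box x e) (fun y => g i (cinv i y) a b).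
  exact: Cinfty_onS OI (g_smooth i a b i).
have H2 y a b : open_box x e y -> g i (cinv i y) a b = g i (cinv i y) b a.
  move=> Oy; have := g_sym i _ (inter y Oy) (domy _ (open_half_box Oy)).
  by move=> /matrixP/(_ b a); rewrite mxE.
have H3 y : open_box x e y -> g i (cinv i y) \in unitmx.
  by move=> Oy; apply/unitmx_nondegenerate/g_nondeg; [apply: inter|apply/domy/open_half_box].
have H4 k a b : Cinfty_on (open_box x e) (fun y => nabla i (cinv i y) k a b).
  exact: Cinfty_onS OI (Gam_smooth i k a b i).
have H5 y k a b : open_box x e y -> nabla i (cinv i y) k a b = nabla i (cinv i y) k b a.
  by move=> Oy; apply: Gam_sym; [apply: inter|apply/domy/open_half_box].
have H6 y a b c : open_box x e y -> pd c (fun z => g i (cinv i z) a b) y =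
    \sum_k (nabla i (cinv i y) k c a * g i (cinv i y) k b
      + nabla i (cinv i y) k c b * g i (cinv i y) a k).
  move=> Oy; rewrite -lc; [|exact: inter|exact/domy/open_half_box].
  by rewrite (partialE _ _ (subU _ (open_half_box Oy))).
have H7 y b c : open_box x e y ->
    coord_ricci (fun k a b z => nabla i (cinv i z) k a b) b c y =
    S / n.+1%:R * g i (cinv i y) b c.
  move=> Oy; have hy := subU _ (open_half_box Oy).
  have [_ /matrixP/(_ b c)] := g_einstein (inter y Oy) (domy _ (open_half_box Oy)).
  rewrite !mxE => <-; apply: eq_bigr => k _.
  by rewrite /riemann !(partialE _ _ hy).
have H8 : Cinfty_on (half_box x e) (rho0 \o cinv i).
  by apply: Cinfty_onS (rs0 i) => y /subU/subW0.
have H9 y : open_box x e y -> 0 < (rho0 \o cinv i) y.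
  move=> Oy; apply: (defining_gt0 rho0_def); last exact: inter.
  by have /subU/subW0/imgP[] := open_half_box Oy.
have H10 : vanishing x e (rho0 \o cinv i).
  move=> y hy y_0; have /imgP[[_ W0y] _ _] := subU _ hy.
  by apply/(r00 _ W0y)/(img_boundary (subU _ hy)).
have H11 k a b : Cinfty_on (half_box x e) (Gb k a b) by apply: Cinfty_onS (Gbs k a b).
have H12 y k a b : open_box x e y -> Gb k a b y = nabla i (cinv i y) k a b
    + (alpha * (rho0 \o cinv i) y)^-1 * pd a (rho0 \o cinv i) y * (k == b)%:R
    + (alpha * (rho0 \o cinv i) y)^-1 * pd b (rho0 \o cinv i) y * (k == a)%:R.
  move=> Oy; have hy := subU _ (open_half_box Oy); have /imgP[[_ W0y] dy _] := hy.
  rewrite /Gb Gb_eq //; last exact: inter.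
  by rewrite /projective_change !mxE !(partialE _ _ hy).
have H13 y k a b : half_box x e y -> `|Gb k a b y| <= Num.max C1 C2.
  move=> hy; rewrite le_max; apply/orP; left.
  exact: (hC1 (k, a, b)) (subU _ hy) (bd1 _ hy).
have H14 y a b : half_box x e y -> `|schouten Gb a b y| <= Num.max C1 C2.
  move=> hy; rewrite le_max; apply/orP; right.
  exact: (hC2 (a, b)) (subU _ hy) (bd2 _ hy).
have H15 : Cinfty_on (half_box x e) (rho \o cinv i).
  by apply: Cinfty_onS (rs i) => y /subU/subW.
have H16 : vanishing x e (rho \o cinv i).
  move=> y hy y_0; have /imgP[[Wy _] _ _] := subU _ hy.
  by apply/(r0 _ Wy)/(img_boundary (subU _ hy)).
have H17 y : open_box x e y -> (rho \o cinv i) y != 0.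
  move=> Oy; rewrite gt_eqF //; apply: (defining_gt0 rho_def); last exact: inter.
  by have /subU/subW/imgP[] := open_half_box Oy.
have H18 := defining_pd rho_def e0 (fun y hy => subW _ (subU y hy)) x0.
have [K [K1 K2 K3]] := chart_asymptotics x0 e0 alpha0 S_neq0 n0 H1 H2 H3 H4 H5 H6 H7
  H8 H9 H10 H11 H12 C12 H13 H14 H15 H16 H18 H17.
exists e => //; exists K; split=> //.
  by move=> y /subU/subW.
move=> y Oy; apply/matrixP => a b; rewrite K2 // !mxE big_ord1 !mxE.
have hy := subU _ (open_half_box Oy).
(* What is left is [(4 lam)^-1 = n (n + 1) / (4 S)]. *)
rewrite -!(partialE _ _ hy) /=; congr (_ + _ * _).
have : n.+1%:R != 0 :> R by rewrite pnatr_eq0.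
have : n%:R != 0 :> R by rewrite pnatr_eq0 -lt0n.
move: (n%:R) (n.+1%:R) => r s rn sn.
by field; rewrite rn sn S_neq0.
Qed.

(** A limit along the normal coordinate line depends on the chart [i] only and on no choice of a
    local extension [K], so the local extensions need no gluing. *)
Definition boundary_limit i p a b : R :=
  lim ((fun t : R => hform i (cinv i (coord i p + t *: evec ord0)) a b) @ 0^'+).

Definition extended_form : tensor02 M := fun i p => \matrix_(a, b)
  if `[< manifold_boundary p >] then boundary_limit i p a b else hform i p a b.

Lemma extended_form_interior i p : manifold_interior p -> extended_form i p = hform i p.
Proof. by move=> ip; apply/matrixP => a b; rewrite mxE asboolF. Qed.

Lemma extended_form_local i p : W p -> dom i p -> manifold_boundary p ->
  exists2 e : R, 0 < e & exists K : 'rV[R]_n.+1 -> 'M[R]_n.+1,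
  [/\ forall a b, Cinfty_on (half_box (coord i p) e) (fun y => K y a b),
      forall y, half_box (coord i p) e y -> extended_form i (cinv i y) = K y &
      forall y, half_box (coord i p) e y -> y 0 ord0 = 0 ->
        nondegenerate_on (@boundary_vectors R n) (K y)].
Proof.
move=> Wp dp bp; have [e e0 [K [sub K1 K2 K3]]] := local_extension Wp dp bp.
exists e => //; exists K; split=> // y hy.
have [_ dy cy] := imgP (sub _ hy).
have [yp|yn] := ltP 0 (y 0 ord0).
  rewrite extended_form_interior; last exact: (img_interior rho_def (sub _ hy)).
  by rewrite K2 //; case: hy.
have y0 : y 0 ord0 = 0 by apply/eqP; rewrite eq_le yn; case: hy.
apply/matrixP => a b; rewrite mxE asboolT; last exact: img_boundary (sub _ hy) y0.
rewrite /boundary_limit cy; apply: cvg_lim => //.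
apply/cvgrPdist_lt => r r0.
have /continuous_onP/(_ y hy r r0)[d d0 hd] := Cinfty_continuous (K1 a b).
have [s s0 hs] := (rel_open_half_box (coord i p) e).2 y hy.
apply/nbhs_ballP; exists (Num.min d s); first by rewrite /= lt_min d0.
move=> t; rewrite -ball_normE /= sub0r normrN lt_min => /andP[td ts] t0.
have tn u : `|t| < u -> `|y + t *: evec ord0 - y| < u.
  by move=> tu; rewrite [y + _]addrC addrK; apply: le_lt_trans (norm_scale_evec _ _) tu.
have ht : open_box (coord i p) e (y + t *: evec ord0).
  have tp : 0 < (y + t *: evec ord0) 0 ord0 by rewrite shift_coord y0 add0r eqxx.
  split=> //; have [] // := hs (y + t *: evec ord0).
  by split; [apply: tn|apply: ltW].
by rewrite -K2 // distrC; apply: hd; [apply: open_half_box|apply: tn].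
Qed.

Lemma Cinfty_hform i a b (A : set 'rV[R]_n.+1) : A `<=` img i W -> rel_open A ->
  (forall y, A y -> 0 < y 0 ord0) -> Cinfty_on A (fun y => hform i (cinv i y) a b).
Proof.
have [_ rs rge r0 dr] := rho_def; have [[_ _ g_smooth] _] := g_metric.
move=> sub Ao A0.
have AI : A `<=` (coord i @` ((@manifold_interior R n M `&` dom i) `&` dom i)).
  move=> y Ay; have [_ dy cy] := imgP (sub _ Ay); exists (cinv i y) => //.
  by split=> //; split=> //; apply: (img_interior rho_def (sub _ Ay)); apply: A0.
have rA : Cinfty_on A (rho \o cinv i) by apply: Cinfty_onS (rs i).
apply: (eq_Cinfty_on (f := fun y => (rho \o cinv i) y * g i (cinv i y) a b
  + (n%:R * n.+1%:R / (4%:R * S)) * (((rho \o cinv i) y)^-1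
    * (pd a (rho \o cinv i) y * pd b (rho \o cinv i) y)))) => //.
  by move=> y Ay; rewrite !mxE big_ord1 !mxE !(partialE _ _ (sub _ Ay)).
apply: CinftyD => //.
  by apply: CinftyM => //; apply: Cinfty_onS AI (g_smooth i a b i).
apply: CinftyM => //; first exact: Cinfty_cst.
apply: CinftyM => //; last by apply: CinftyM => //; apply: Cinfty_pd.
apply: CinftyV => // y Ay; have [Wy _ _] := imgP (sub _ Ay).
rewrite gt_eqF //; apply: (defining_gt0 rho_def Wy).
by apply: (img_interior rho_def (sub _ Ay)); apply: A0.
Qed.

Lemma Cinfty_extended_form i a b :
  Cinfty_on (img i W) (fun y => extended_form i (cinv i y) a b).
Proof.
have Uo := rel_open_img i Wo; apply: Cinfty_local; first exact: Uo.1.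
move=> y Uy; have [Wy dy cy] := imgP Uy.
have [yp|yn] := ltP 0 (y 0 ord0); last first.
  have y0 : y 0 ord0 = 0 by apply/eqP; rewrite eq_le yn; apply: Uo.1.
  have [e e0 [K [K1 K2 _]]] := extended_form_local Wy dy (img_boundary Uy y0).
  rewrite cy in K1 K2; exists (half_box y e); split.
  - exact: rel_open_half_box.
  - by split; [rewrite subrr normr0|apply: Uo.1].
  - by apply: eq_Cinfty_on (K1 a b) => [|z hz]; [exact: rel_open_half_box|rewrite K2].
have [e e0 sub] := Uo.2 y Uy.
have sub' : open_box y e `<=` img i W by move=> z /open_half_box/sub.
exists (open_box y e); split.
- exact: rel_open_open_box.
- by split=> //; rewrite subrr normr0.
- apply: (eq_Cinfty_on (f := fun z => hform i (cinv i z) a b)).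
  + exact: rel_open_open_box.
  + move=> z [z1 z0]; rewrite extended_form_interior //.
    by apply: (img_interior rho_def (sub' z (conj z1 z0)) z0).
  + by apply: Cinfty_hform sub' (rel_open_open_box _ _) _ => z [].
Qed.

(** Components taken in chart [i] have to be smooth when read in every chart [j]: they are composed
    with the smooth transition map. *)
Lemma smooth_extended_form i a b : smooth_on (W `&` dom i) (fun p => extended_form i p a b).
Proof.
move=> j; have Ao : rel_open (img j (W `&` dom i)).
  by apply: rel_open_img; apply: openI => //; apply: open_dom.
have H : Cinfty_on (img j (W `&` dom i))
    ((fun y => extended_form i (cinv i y) a b) \o (fun y => coord i (cinv j y))).
  apply: (Cinfty_comp Ao (rel_open_img i Wo)) => [y||c].
  - by move=> /imgP[[Wy dy] _ _]; apply: img_coord.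
  - exact: Cinfty_extended_form.
  - apply: Cinfty_onS (atlas_compatible j i c) => y [q [[_ qi] qj] <-].
    by exists q.
apply: (eq_Cinfty_on Ao _ H) => y /imgP[[_ dy] _ _].
rewrite -[LHS]/(extended_form i (cinv i (coord i (cinv j y))) a b).
by rewrite (coordK dy).
Qed.

Lemma hform_sym i p : manifold_interior p -> dom i p -> (hform i p)^T = hform i p.
Proof.
move=> ip dp; have [[g_sym _ _] _] := g_metric.
apply/matrixP => a b; have /matrixP/(_ a b) := g_sym i p ip dp.
rewrite mxE => gs; rewrite !mxE gs !big_ord1 !mxE.
by rewrite [partial i b rho p * _]mulrC.
Qed.

Lemma hform_change i j p : W p -> manifold_interior p -> dom i p -> dom j p ->
  hform i p = jacobian i j p *m hform j p *m (jacobian i j p)^T.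
Proof.
move=> Wp ip di dj; have [[_ g_change _] _] := g_metric.
rewrite /hform mulmxDr mulmxDl -!scalemxAr -!scalemxAl -g_change //.
rewrite /differential_sq (differential_change rho_def Wp ip di dj).
by rewrite trmx_mul trmxK !mulmxA.
Qed.

(** Symmetry and the transformation law are identities between functions continuous up to the
    boundary, so it suffices to check them for [hform] at interior points. *)
Lemma extended_form_tensor : smooth_sym_tensor_on W extended_form.
Proof.
split; last exact: smooth_extended_form.
- move=> i p Wp dp; apply/matrixP => a b; rewrite mxE.
  have := @eq_on_rel_open (img i W) (fun y => extended_form i (cinv i y) b a)
    (fun y => extended_form i (cinv i y) a b) (rel_open_img i Wo)
    (Cinfty_continuous (Cinfty_extended_form i b a))
    (Cinfty_continuous (Cinfty_extended_form i a b)) _ _ (img_coord Wp dp).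
  rewrite coordK //; apply => y Uy y0; have iy := img_interior rho_def Uy y0.
  have [_ dy _] := imgP Uy.
  by rewrite !extended_form_interior // -{1}hform_sym // mxE.
- move=> i j p Wp di dj; apply/matrixP => a b.
  have Ao : rel_open (img i (W `&` dom j)).
    by apply: rel_open_img; apply: openI => //; apply: open_dom.
  have sub : img i (W `&` dom j) `<=` img i W.
    by move=> y [q [[Wq _] dq] <-]; exists q.
  have Js c l : Cinfty_on (img i (W `&` dom j)) (fun y => jacobian i j (cinv i y) c l).
    apply: (eq_Cinfty_on (f := pd c (fun y => coord j (cinv i y) 0 l))) => //.
      by move=> y Uy; rewrite mxE (partialE _ _ Uy).
    apply: Cinfty_pd; apply: Cinfty_onS (atlas_compatible i j l) => y [q [[_ qj] qi] <-].
    by exists q.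
  have hs c l : Cinfty_on (img i (W `&` dom j)) (fun y => extended_form j (cinv i y) c l).
    exact: smooth_extended_form.
  have := @eq_on_rel_open (img i (W `&` dom j)) (fun y => extended_form i (cinv i y) a b)
    (fun y => \sum_k (\sum_l jacobian i j (cinv i y) a l * extended_form j (cinv i y) l k)
      * jacobian i j (cinv i y) b k) Ao _ _ _ (coord i p).
  rewrite coordK // => ->.
  + by rewrite congruence_entry.
  + by apply: Cinfty_continuous; apply: Cinfty_onS sub (Cinfty_extended_form i a b).
  + apply: Cinfty_continuous; apply: Cinfty_sum => // k _; apply: CinftyM => //.
    by apply: Cinfty_sum => // l _; apply: CinftyM.
  + move=> y Uy y0; have [[Wy dj'] di' _] := imgP Uy.
    have iy := img_interior rho_def (sub _ Uy) y0.
    by rewrite !extended_form_interior // (hform_change Wy iy di' dj') congruence_entry.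
  + exact: img_coord.
Qed.

Lemma extended_form_nondegenerate i p : W p -> manifold_boundary p -> dom i p ->
  nondegenerate_on (@boundary_vectors R n) (extended_form i p).
Proof.
move=> Wp bp dp; have [e e0 [K [_ K2 K3]]] := extended_form_local Wp dp bp.
have hx : half_box (coord i p) e (coord i p).
  by split; [rewrite subrr normr0|apply: coord_ge0].
have := K2 _ hx; rewrite coordK // => ->; apply: K3 => //.
exact: boundary_coord rho_def _ _ _ _ _.
Qed.

End Einstein.
End ManifoldAssembly.

Unset Implicit Arguments.

Theorem proposition3p6 (R : realType) (n : nat) (M : bd_manifold R n)
    (g : tensor02 M) (nabla : connection M) (S : R)
    (g_metric : pseudo_riemannian g)
    (nabla_lc : levi_civita g nabla)
    (g_compact : projectively_compact nabla)
    (g_einstein : einstein_with_scalar_curvature g nabla S)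
    (S_neq0 : S != 0)
    (W : set M) (rho : M -> R) (rho_def : local_defining_function W rho) :
  exists h : tensor02 M,
    [/\ smooth_sym_tensor_on W h,
        forall i p, W p -> manifold_interior p -> dom i p ->
          h i p = rho p *: g i p
                  + (n%:R * n.+1%:R / (4%:R * S))
                    *: ((rho p)^-1 *: differential_sq rho i p),
        forall i p, W p -> manifold_boundary p -> dom i p ->
          nondegenerate_on (@boundary_vectors R n) (h i p) &
        forall i p, W p -> manifold_interior p -> dom i p ->
          g i p = (rho p)^-1 *: h i p
                  + (- (n%:R * n.+1%:R) / (4%:R * S))
                    *: ((rho p ^+ 2)^-1 *: differential_sq rho i p)].
Proof.
exists (extended_form g S rho); split.
- exact: (extended_form_tensor g_metric nabla_lc g_compact g_einstein S_neq0 rho_def).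
- by move=> i p Wp ip dp; rewrite extended_form_interior.
- move=> i p; exact: (extended_form_nondegenerate g_metric nabla_lc g_compact
    g_einstein S_neq0 rho_def).
- move=> i p Wp ip dp; rewrite extended_form_interior //.
  have rn : rho p != 0 by rewrite gt_eqF // (defining_gt0 rho_def).
  apply/matrixP => a b; rewrite !mxE.
  by field; rewrite rn S_neq0.
Qed.
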